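(* The torsion $\mathbf T$ of the Cartan canonical connection of $RGOGML^n_p$ is determined by seven effective local d-tensors, namely (together with the vanishing component $R^{(m)}_{(\mu)\alpha j}$) $$T^m_{\alpha j}=-G^m_{j\alpha},\quad P^{(m)\;\;(\beta)}_{(\mu)\alpha(j)}=-\delta^\beta_\mu G^m_{j\alpha},\quad P^{(m)\;(\beta)}_{(\mu)i(j)}=-\delta^\beta_\mu\Lambda^m_{ij},$$ $$P^{m(\beta)}_{i(j)}=\stackrel{1}{C}{}^{\beta m}_{ij}+\stackrel{0}{C}{}^{\beta m}_{ij},\quad S^{(m)(\alpha)(\beta)}_{(\mu)(i)(j)}=\delta^\alpha_\mu C^{m(\beta)}_{i(j)}-\delta^\beta_\mu C^{m(\alpha)}_{i(j)},$$ $$R^{(m)}_{(\mu)\alpha\beta}=-H^\gamma_{\mu\alpha\beta}x^m_\gamma,\quad R^{(m)}_{(\mu)\alpha j}=0,\quad R^{(m)}_{(\mu)ij}=r^m_{kij}x^k_\mu,$$ where $H^\gamma_{\mu\alpha\beta}$ and $r^m_{ijk}$ are the local curvature tensors of the semi-Riemannian metrics $h_{\alpha\beta}$ and $\varphi_{ij}$ respectively.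
   Context: Setting. $T$ and $M$ are smooth manifolds of dimensions $p$ and $n$, with local coordinates $(t^\alpha)$ (Greek indices) and $(x^i)$ (Latin indices), and semi-Riemannian metrics $h_{\alpha\beta}(t)$, $\varphi_{ij}(x)$ with Christoffel symbols $H^\alpha_{\beta\gamma}$, $\gamma^i_{jk}$. $J^1(T,M)$ is the 1-jet bundle with induced coordinates $(t^\alpha,x^i,x^i_\alpha)$. Repeated indices are summed. $A_i(t^\gamma,x^k,x^k_\gamma)$ are the components of a d-tensor on $J^1(T,M)$ (transforming like a covector on $M$). Put $g_{ij}=\varphi_{ij}+A_iA_j$, assumed of rank $n$ and constant signature, $A^i=\varphi^{im}A_m$, $A_0=A^mA_m$, so $g^{ij}=\varphi^{ij}-\frac{1}{1+A_0}A^iA^j$. $RGOGML^n_p$ is $J^1(T,M)$ with the vertical metrical d-tensor $h^{\alpha\beta}g_{ij}$ and the nonlinear connection $\Gamma$: $M^{(i)}_{(\alpha)\beta}=-H^\mu_{\alpha\beta}x^i_\mu$, $N^{(i)}_{(\alpha)j}=\gamma^i_{jm}x^m_\alpha$. Adapted basis: $\frac{\delta}{\delta t^\alpha}=\frac{\partial}{\partial t^\alpha}-M^{(j)}_{(\beta)\alpha}\frac{\partial}{\partial x^j_\beta}$, $\frac{\delta}{\delta x^i}=\frac{\partial}{\partial x^i}-N^{(j)}_{(\beta)i}\frac{\partial}{\partial x^j_\beta}$, $\frac{\partial}{\partial x^i_\alpha}$. Cartan canonical connection $C\Gamma=(H^\gamma_{\alpha\beta},G^i_{j\gamma},L^i_{jk},C^{i(\gamma)}_{j(k)})$: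 $G^i_{j\gamma}=\frac12g^{im}\frac{\delta g_{mj}}{\delta t^\gamma}$, $L^i_{jk}=\frac12g^{im}\left(\frac{\delta g_{jm}}{\delta x^k}+\frac{\delta g_{km}}{\delta x^j}-\frac{\delta g_{jk}}{\delta x^m}\right)$, $C^{i(\gamma)}_{j(k)}=\frac12g^{im}\left(\frac{\partial g_{jm}}{\partial x^k_\gamma}+\frac{\partial g_{km}}{\partial x^j_\gamma}-\frac{\partial g_{jk}}{\partial x^m_\gamma}\right)$, and $\nabla$ acts by: along $\delta/\delta t^\gamma$: $\frac{\delta}{\delta t^\beta}\mapsto H^\alpha_{\beta\gamma}\frac{\delta}{\delta t^\alpha}$, $\frac{\delta}{\delta x^j}\mapsto G^i_{j\gamma}\frac{\delta}{\delta x^i}$, $\frac{\partial}{\partial x^i_\beta}\mapsto(\delta^\beta_\alpha G^k_{i\gamma}-\delta^k_iH^\beta_{\alpha\gamma})\frac{\partial}{\partial x^k_\alpha}$; along $\delta/\delta x^k$: $\frac{\delta}{\delta t^\beta}\mapsto0$, $\frac{\delta}{\delta x^j}\mapsto L^i_{jk}\frac{\delta}{\delta x^i}$, $\frac{\partial}{\partial x^j_\beta}\mapsto L^i_{jk}\frac{\partial}{\partial x^i_\beta}$; along $\partial/\partial x^k_\gamma$: $\frac{\delta}{\delta t^\beta}\mapsto0$, $\frac{\delta}{\delta x^j}\mapsto C^{i(\gamma)}_{j(k)}\frac{\delta}{\delta x^i}$, $\frac{\partial}{\partial x^j_\beta}\mapsto C^{i(\gamma)}_{j(k)}\frac{\partial}{\partial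 x^i_\beta}$. Notation. $\gamma_{ijm}=\varphi_{ml}\gamma^l_{ij}$, $A_{ijm}=\frac12\left[\frac{\delta(A_iA_m)}{\delta x^j}+\frac{\delta(A_jA_m)}{\delta x^i}-\frac{\delta(A_iA_j)}{\delta x^m}\right]$, $C^\gamma_{ijm}=\frac12\left[\frac{\partial(A_iA_m)}{\partial x^j_\gamma}+\frac{\partial(A_jA_m)}{\partial x^i_\gamma}-\frac{\partial(A_iA_j)}{\partial x^m_\gamma}\right]$; a lower index $0$ means contraction of the last index with $A^m$ (e.g. $A_{jk0}=A_{jkm}A^m$). Then $\Lambda^i_{jk}=\varphi^{im}A_{jkm}-\frac{(\gamma_{jk0}+A_{jk0})A^i}{1+A_0}$, $\stackrel{1}{C}{}^{\gamma i}_{jk}=\varphi^{im}C^\gamma_{jkm}$, $\stackrel{0}{C}{}^{\gamma i}_{jk}=-\frac{C^\gamma_{jk0}A^i}{1+A_0}$. Curvature conventions: $H^\alpha_{\eta\beta\gamma}=\frac{\partial H^\alpha_{\eta\beta}}{\partial t^\gamma}-\frac{\partial H^\alpha_{\eta\gamma}}{\partial t^\beta}+H^\mu_{\eta\beta}H^\alpha_{\mu\gamma}-H^\mu_{\eta\gamma}H^\alpha_{\mu\beta}$, and $r^l_{ijk}=\frac{\partial\gamma^l_{ij}}{\partial x^k}-\frac{\partial\gamma^l_{ik}}{\partial x^j}+\gamma^m_{ij}\gamma^l_{mk}-\gamma^m_{ik}\gamma^l_{mj}$. Torsion components, with $\mathbf T(X,Y)=\nabla_XY-\nabla_YX-[X,Y]$: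 $\mathbf T(\frac{\delta}{\delta t^\beta},\frac{\delta}{\delta t^\alpha})=R^{(m)}_{(\mu)\alpha\beta}\frac{\partial}{\partial x^m_\mu}$; $\mathbf T(\frac{\delta}{\delta x^j},\frac{\delta}{\delta t^\alpha})=T^m_{\alpha j}\frac{\delta}{\delta x^m}+R^{(m)}_{(\mu)\alpha j}\frac{\partial}{\partial x^m_\mu}$; $\mathbf T(\frac{\delta}{\delta x^j},\frac{\delta}{\delta x^i})=R^{(m)}_{(\mu)ij}\frac{\partial}{\partial x^m_\mu}$; $\mathbf T(\frac{\partial}{\partial x^j_\beta},\frac{\delta}{\delta t^\alpha})=P^{(m)\;\;(\beta)}_{(\mu)\alpha(j)}\frac{\partial}{\partial x^m_\mu}$; $\mathbf T(\frac{\partial}{\partial x^j_\beta},\frac{\delta}{\delta x^i})=P^{m(\beta)}_{i(j)}\frac{\delta}{\delta x^m}+P^{(m)\;(\beta)}_{(\mu)i(j)}\frac{\partial}{\partial x^m_\mu}$; $\mathbf T(\frac{\partial}{\partial x^j_\beta},\frac{\partial}{\partial x^i_\alpha})=S^{(m)(\alpha)(\beta)}_{(\mu)(i)(j)}\frac{\partial}{\partial x^m_\mu}$. That these are the only possibly nonzero adapted components is part of the meaning of ''determined by''. *)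

(* Defs.v *)
From HB Require Import structures.
From mathcomp Require Import all_boot all_order all_algebra.
From mathcomp Require Import all_classical all_reals all_analysis.
Set Implicit Arguments.
Unset Strict Implicit.
Unset Printing Implicit Defensive.
Import Order.TTheory GRing.Theory Num.Theory.
Import numFieldNormedType.Exports.
Local Open Scope classical_set_scope.
Local Open Scope ring_scope.

Section Smooth.
Context {R : realType} {V : normedModType R}.

(* For k > 0 and U open this is the usual class C^k: f is Frechet
   differentiable on U and its directional derivatives are of class C^(k-1). *)
Fixpoint classC (k : nat) (U : set V) (f : V -> R) : Prop :=
  if k is k'.+1 then
    (forall x, U x -> differentiable f x) /\
    (forall v : V, classC k' U ('D_v f))
  else forall x, U x -> {for x, continuous f}.

Definition smooth (U : set V) (f : V -> R) : Prop := forall k, classC k U f.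

End Smooth.

(* A manifold is given with a smooth atlas, indexed by [chart]; [dom c] is the
   domain of the chart c, [coo c] its coordinate map and [pt c] the inverse
   parametrization. *)
Record manifold (R : realType) (m : nat) := Manifold {
  pts : topologicalType;
  chart : Type;
  dom : chart -> set pts;
  coo : chart -> pts -> 'rV[R]_m;
  pt : chart -> 'rV[R]_m -> pts;
  pts_hausdorff : hausdorff_space pts;
  pts_second_countable : @second_countable pts;
  dom_open : forall c, open (dom c);
  img_open : forall c, open (coo c @` dom c);
  dom_cover : forall x : pts, exists c, dom c x;
  cooK : forall c x, dom c x -> pt c (coo c x) = x;
  coo_continuous : forall c, {within dom c, continuous (coo c)};
  pt_continuous : forall c, {within coo c @` dom c, continuous (pt c)};
  transition_smooth : forall c c' j,
    smooth (coo c @` (dom c `&` dom c'))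
           (fun x : 'rV[R]_m => coo c' (pt c x) 0 j)
}.

Section Transition.
Context {R : realType} {m : nat} {T : manifold R m}.

Definition img (c : chart T) : set 'rV[R]_m := coo c @` dom c.

Definition overlap (c c' : chart T) : set 'rV[R]_m :=
  coo c @` (dom c `&` dom c').

Definition trans (c c' : chart T) (x : 'rV[R]_m) : 'rV[R]_m :=
  coo c' (pt c x).

(* The entry (a', a) is the partial derivative of x'^a' with respect to x^a;
   this is the transpose of the row-vector Jacobian 'J of the library. *)
Definition jac (c c' : chart T) (x : 'rV[R]_m) : 'M[R]_m :=
  \matrix_(a', a) 'D_(delta_mx 0 a) (fun y : 'rV[R]_m => trans c c' y 0 a') x.

End Transition.

Section Signature.
Context {R : realType} {m : nat}.

Definition has_signature (S : 'M[R]_m) (r s : nat) : Prop :=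
  (r + s <= m)%N /\
  exists2 P : 'M[R]_m, P \in unitmx &
    P^T *m S *m P =
    diag_mx (\row_(i < m) (if (i < r)%N then 1
                           else if (i < r + s)%N then -1 else 0)).

End Signature.

Record semi_riemannian (R : realType) (m : nat) (T : manifold R m) :=
  SemiRiemannian {
  metric :> chart T -> 'rV[R]_m -> 'M[R]_m;
  metric_smooth : forall c i j, smooth (img c) (fun x => metric c x i j);
  metric_sym : forall c x, img c x -> (metric c x)^T = metric c x;
  metric_nondegenerate : forall c x, img c x -> metric c x \in unitmx;
  metric_signature : exists r s,
    forall c x, img c x -> has_signature (metric c x) r s;
  metric_change : forall c c' x, overlap c c' x ->
    metric c x = (jac c c' x)^T *m metric c' (trans c c' x) *m jac c c' x
}.

Section Christoffel.
Context {R : realType} {m : nat}.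
Implicit Type q : 'rV[R]_m -> 'M[R]_m.

(* The upper index comes first. *)
Definition christoffel q (i j k : 'I_m) (x : 'rV[R]_m) : R :=
  2^-1 * \sum_(l < m) invmx (q x) i l *
    ('D_(delta_mx 0 k) (fun y : 'rV[R]_m => q y j l) x
     + 'D_(delta_mx 0 j) (fun y : 'rV[R]_m => q y k l) x
     - 'D_(delta_mx 0 l) (fun y : 'rV[R]_m => q y j k) x).

(* [curvature q l i j k] is r^l_{ijk}. *)
Definition curvature q (l i j k : 'I_m) (x : 'rV[R]_m) : R :=
  'D_(delta_mx 0 k) (christoffel q l i j) x
  - 'D_(delta_mx 0 j) (christoffel q l i k) x
  + \sum_(s < m) (christoffel q s i j x * christoffel q l s k x
                  - christoffel q s i k x * christoffel q l s j x).

End Christoffel.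

(* Induced coordinates u = (t, x, v) on the 1-jet bundle, v i alpha = x^i_alpha *)
Notation jet R p n := ('rV[R]_p * 'rV[R]_n * 'M[R]_(n, p))%type.

(* Labels of the adapted basis: [IT a] for delta/delta t^a, [IX i] for
   delta/delta x^i and [IV i a] for d/d x^i_a. *)
Notation idx p n := ('I_p + 'I_n + 'I_n * 'I_p)%type.
Notation IT a := (inl (inl a)).
Notation IX i := (inl (inr i)).
Notation IV i a := (inr (i, a)).

(* Coordinate expressions, on the domain of one induced chart, of the metrics
   h and phi and of the d-covector A. *)
Record local_data (R : realType) (p n : nat) := LocalData {
  hl : 'rV[R]_p -> 'M[R]_p;
  phil : 'rV[R]_n -> 'M[R]_n;
  Al : jet R p n -> 'rV[R]_n
}.

Section LocalGeometry.
Context {R : realType} {p n : nat} (S : local_data R p n).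
Local Notation J := (jet R p n).
Local Notation I := (idx p n).
Implicit Types (u w : J) (a b e : I).
Implicit Types (i j k l m : 'I_n) (al be ga mu : 'I_p).

Definition H al be ga u : R := christoffel (hl S) al be ga u.1.1.
Definition gam i j k u : R := christoffel (phil S) i j k u.1.2.

(* M^(i)_(al)be and N^(i)_(al)j *)
Definition Mcon i al be u : R := - \sum_mu H mu al be u * u.2 i mu.
Definition Ncon i al j u : R := \sum_m gam i j m u * u.2 m al.

Definition delta_t al : J -> J := fun u =>
  (delta_mx 0 al, 0, \matrix_(j, be) - Mcon j be al u).
Definition delta_x i : J -> J := fun u =>
  (0, delta_mx 0 i, \matrix_(j, be) - Ncon j be i u).
Definition partial_v i al : J -> J := fun _ => (0, 0, delta_mx i al).

Definition frame a : J -> J :=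
  match a with
  | IT al => delta_t al
  | IX i => delta_x i
  | IV i al => partial_v i al
  end.

(* The dual basis dt^al, dx^i,
   delta x^i_al = dx^i_al + M^(i)_(al)be dt^be + N^(i)_(al)j dx^j, at u. *)
Definition coframe a u w : R :=
  match a with
  | IT al => w.1.1 0 al
  | IX i => w.1.2 0 i
  | IV i al => w.2 i al + \sum_be Mcon i al be u * w.1.1 0 be
                        + \sum_j Ncon i al j u * w.1.2 0 j
  end.

Definition phi i j u : R := phil S u.1.2 i j.
Definition phi_inv i j u : R := invmx (phil S u.1.2) i j.
Definition A i u : R := Al S u 0 i.
Definition A_up i u : R := \sum_m phi_inv i m u * A m u.
Definition A_0 u : R := \sum_m A_up m u * A m u.

Definition gmx u : 'M[R]_n := \matrix_(i, j) (phi i j u + A i u * A j u).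
Definition g i j u : R := gmx u i j.
Definition g_inv i j u : R := invmx (gmx u) i j.

(* Derivative of a function along a vector field. *)
Definition along (X : J -> J) (f : J -> R) : J -> R := fun u => 'D_(X u) f u.

(* G^i_{j ga}, L^i_{jk} and C^{i(ga)}_{j(k)} *)
Definition Gcoef i j ga u : R :=
  2^-1 * \sum_m g_inv i m u * along (delta_t ga) (g m j) u.
Definition Lcoef i j k u : R :=
  2^-1 * \sum_m g_inv i m u *
    (along (delta_x k) (g j m) u + along (delta_x j) (g k m) u
     - along (delta_x m) (g j k) u).
Definition Ccoef i ga j k u : R :=
  2^-1 * \sum_m g_inv i m u *
    (along (partial_v k ga) (g j m) u + along (partial_v j ga) (g k m) u
     - along (partial_v m ga) (g j k) u).

(* [cartan a b e] is the e-component of nabla_{frame a} (frame b). *)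
Definition cartan a b e u : R :=
  match a, b, e with
  | IT ga, IT be, IT al => H al be ga u
  | IT ga, IX j, IX i => Gcoef i j ga u
  | IT ga, IV i be, IV k al =>
      (be == al)%:R * Gcoef k i ga u - (k == i)%:R * H be al ga u
  | IX k, IX j, IX i => Lcoef i j k u
  | IX k, IV j be, IV i al => (be == al)%:R * Lcoef i j k u
  | IV k ga, IX j, IX i => Ccoef i ga j k u
  | IV k ga, IV j be, IV i al => (be == al)%:R * Ccoef i ga j k u
  | _, _, _ => 0
  end.

(* Linear connection with coefficients [cartan] in the adapted basis:
   the coefficients are extended to all vector fields by the Leibniz rule. *)
Definition nabla (X Y : J -> J) : J -> J := fun u =>
  \sum_e (along X (fun w => coframe e w (Y w)) u
          + \sum_a \sum_b coframe a u (X u) * coframe b u (Y u)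
                          * cartan a b e u) *: frame e u.

Definition bracket (X Y : J -> J) : J -> J := fun u =>
  'D_(X u) Y u - 'D_(Y u) X u.

Definition torsion (X Y : J -> J) : J -> J := fun u =>
  nabla X Y u - nabla Y X u - bracket X Y u.

(* Adapted components of the torsion. *)
Definition torsion_comp a b e u : R :=
  coframe e u (torsion (frame a) (frame b) u).

(* gamma_{ijm} and A_{ijm}, then their contractions gamma_{ij0} and A_{ij0} *)
Definition gam_low i j m u : R := \sum_l phi m l u * gam l i j u.
Definition A_low i j m u : R :=
  2^-1 * (along (delta_x j) (fun w => A i w * A m w) u
          + along (delta_x i) (fun w => A j w * A m w) u
          - along (delta_x m) (fun w => A i w * A j w) u).
Definition gam_low0 i j u : R := \sum_m gam_low i j m u * A_up m u.
Definition A_low0 i j u : R := \sum_m A_low i j m u * A_up m u.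

(* C^ga_{ijm} and C^ga_{ij0} *)
Definition C_low ga i j m u : R :=
  2^-1 * (along (partial_v j ga) (fun w => A i w * A m w) u
          + along (partial_v i ga) (fun w => A j w * A m w) u
          - along (partial_v m ga) (fun w => A i w * A j w) u).
Definition C_low0 ga i j u : R := \sum_m C_low ga i j m u * A_up m u.

Definition Lambda i j k u : R :=
  \sum_m phi_inv i m u * A_low j k m u
  - (gam_low0 j k u + A_low0 j k u) * A_up i u / (1 + A_0 u).
Definition C1 ga i j k u : R := \sum_m phi_inv i m u * C_low ga j k m u.
Definition C0 ga i j k u : R :=
  - (C_low0 ga j k u * A_up i u / (1 + A_0 u)).

End LocalGeometry.

Section JetCharts.
Context {R : realType} {p n : nat} {T : manifold R p} {M : manifold R n}.
Local Notation J := (jet R p n).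

(* A pair of charts of T and M induces the chart of the 1-jet bundle with
   image [jet_img c d]. *)
Definition jet_img (c : chart T) (d : chart M) : set J :=
  [set u | img c u.1.1 /\ img d u.1.2].

Definition jet_overlap (c c' : chart T) (d d' : chart M) : set J :=
  [set u | overlap c c' u.1.1 /\ overlap d d' u.1.2].

(* x'^i_al = (dx'^i/dx^j) (dt^be/dt'^al) x^j_be *)
Definition jet_trans (c c' : chart T) (d d' : chart M) (u : J) : J :=
  (trans c c' u.1.1, trans d d' u.1.2,
   jac d d' u.1.2 *m u.2 *m jac c' c (trans c c' u.1.1)).

(* Matrix of the change of adapted bases: block diagonal, built on the
   Jacobians of the changes of coordinates on T and on M. *)
Definition djac (c c' : chart T) (d d' : chart M) (e' e : idx p n) (u : J) : R :=
  match e', e with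
  | IT al', IT al => jac c c' u.1.1 al' al
  | IX i', IX i => jac d d' u.1.2 i' i
  | IV i' al', IV i al =>
      jac d d' u.1.2 i' i * jac c' c (trans c c' u.1.1) al al'
  | _, _ => 0
  end.

(* F is a family of adapted components, of type (1,2), in all the induced
   charts. As [djac] is block diagonal, each block of F (a, b and e
   ranging over indices of fixed kinds) obeys its own tensorial law: every block
   is a d-tensor. *)
Definition d_tensor12
    (F : chart T -> chart M -> idx p n -> idx p n -> idx p n -> J -> R) : Prop :=
  forall (c c' : chart T) (d d' : chart M) (u : J), jet_overlap c c' d d' u ->
  forall a b e' : idx p n,
    \sum_e djac c c' d d' e' e u * F c d a b e u =
    \sum_a' \sum_b' djac c c' d d' a' a u * djac c c' d d' b' b u
                    * F c' d' a' b' e' (jet_trans c c' d d' u).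

End JetCharts.

Record rgogml (R : realType) (p n : nat)
    (T : manifold R p) (M : manifold R n) := RGOGML {
  hmet : semi_riemannian T;
  phimet : semi_riemannian M;
  Acov : chart T -> chart M -> jet R p n -> 'rV[R]_n;
  local c d := LocalData (hmet c) (phimet d) (Acov c d);
  A_smooth : forall c d i, smooth (jet_img c d) (fun u => Acov c d u 0 i);
  A_change : forall c c' d d' u, jet_overlap c c' d d' u ->
    Acov c d u = Acov c' d' (jet_trans c c' d d' u) *m jac d d' u.1.2;
  g_rank : forall c d u, jet_img c d u -> \rank (gmx (local c d) u) = n;
  g_signature : exists r s, forall c d u, jet_img c d u ->
    has_signature (gmx (local c d) u) r s
}.

(* Main.v *)
Require Import Defs.
From HB Require Import structures.
From mathcomp Require Import all_boot all_order all_algebra.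
From mathcomp Require Import lra ring.
From mathcomp Require Import all_classical all_reals all_analysis.
Import Order.TTheory GRing.Theory Num.Theory.
Import numFieldNormedType.Exports.
Local Open Scope classical_set_scope.
Local Open Scope ring_scope.
Set Implicit Arguments.
Unset Strict Implicit.
Unset Printing Implicit Defensive.

(** In the adapted frame the torsion is a pointwise bilinear form. For a frame with
    dual coframe [theta] and connection coefficients [Gamma], its [e]-component on
    [(x, y)] is
<<
      (x theta_e) y - (y theta_e) x
        + sum_ab theta_a x * theta_b y * (Gamma_abe - Gamma_bae),
>>
    the derivatives of the arguments cancelling against the bracket
    ([torsion_formP]). Hence the torsion is determined by its values on pairs of
    frame vectors, and each component is read off from derivatives of the nonlinear
    connection [M], [N] and from the coefficients of the Cartan connection
    ([torsion_comp_hor], [torsion_comp_vert]). Since [M] and [N] are linear in the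
    velocities with Christoffel symbols as coefficients, the antisymmetrized
    derivatives of [M] and of [N] are the curvatures of [h] and of [phi] contracted
    with the velocity, and the mixed ones cancel. What remains is algebra: the
    Sherman-Morrison formula for the inverse of [phi + A A] splits [L] into
    [gamma + Lambda] and [C] into [C1 + C0] ([Lcoef_Lambda], [Ccoef_C1_C0]).

    For the tensorial character, the derivative of a change of jet coordinates maps
    the adapted frame to the adapted frame by a block diagonal matrix
    ([der_jet_trans_t], [der_jet_trans_x], [der_jet_trans_v]); the Christoffel law of
    [h] and [phi] cancels the second derivatives of the coordinate changes.
    Differentiating [g] along the frame then shows that [G] and [C] are tensors and
    that [L] has the same inhomogeneous law as the Christoffel symbols of [phi], so
    that [L - gamma] is a tensor ([G_mx_change], [C_mx_change],
    [L_sub_christoffel_change]). One lemma on matrices, [christoffel2_change],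
    yields the laws of the Christoffel symbols, of [L] and of [C]. Differentiating the Christoffel law once more, with second
    derivatives commuting, gives the tensoriality of the curvatures
    ([curvature_mx_change]). *)

(** * Directional derivatives *)

(** Sealed, because comparing two distinct directional derivatives would otherwise
    unfold the limits that define them. *)
HB.lock Definition der {R : realType} {V W : normedModType R}
  (v : V) (f : V -> W) (x : V) : W := 'D_v f x.

Section Calculus.
Context {R : realType} {V W : normedModType R}.

Lemma derE (v : V) (f : V -> W) (x : V) : der v f x = 'D_v f x.
Proof. by rewrite der.unlock. Qed.

Lemma near_eq_differentiable (f g : V -> W) (x : V) :
  (\forall y \near x, f y = g y) -> differentiable f x -> differentiable g x.
Proof.
move=> fg df; have fgx := nbhs_singleton fg.
have [dfc dfE] := (diff_locallyP _ _).1 df.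
have gE : g \o shift x = cst (g x) + 'd f x +o_ 0 id.
  apply/eqaddoP => _/posnumP[e].
  have /eqaddoP /(_ e%:num) /(_ [gt0 of e%:num]) := dfE.
  have : \forall h \near (0 : V), f (h + x) = g (h + x).
    by move: fg; rewrite (near_shift 0 x); apply: filterS => h; rewrite /= subr0.
  apply: filterS2 => h /= E.
  have -> : (f \o shift x - (cst (f x) + 'd f x)) h = (g \o shift x - (cst (g x) + 'd f x)) h.
    by rewrite /= -[LHS]/(f (h + x) - (f x + 'd f x h)) E fgx.
  by [].
apply/diff_locallyP.
by rewrite (diff_unique dfc gE); split.
Qed.

Lemma der_fsum (I : finType) (f : I -> V -> W) (x v : V) :
  (forall i, differentiable (f i) x) ->
  der v (fun y => \sum_i f i y) x = \sum_i der v (f i) x.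
Proof.
rewrite der.unlock => df; rewrite -fct_sumE.
suff [] : derivable (\sum_i f i) x v /\
  'D_v (\sum_i f i) x = \sum_i 'D_v (f i) x by [].
elim/big_ind2: _ => [|f1 y1 f2 y2 [d1 <-] [d2 <-]|i _].
- by split; [exact: derivable_cst|exact: derive_cst].
- by split; [apply: derivableD; [exact: d1|exact: d2]|apply: deriveD; [exact: d1|exact: d2]].
- by split => //; apply: diff_derivable; exact: df.
Qed.

Lemma differentiable_fsum (I : finType) (f : I -> V -> W) (x : V) :
  (forall i, differentiable (f i) x) ->
  differentiable (fun y => \sum_i f i y) x.
Proof.
move=> df; rewrite -fct_sumE.
elim/big_ind: _ => [|f1 f2 d1 d2|i _]; first exact: differentiable_cst.
  by apply: differentiableD; [exact: d1|exact: d2].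
exact: df.
Qed.

Lemma derD (f g : V -> W) (x v : V) :
  differentiable f x -> differentiable g x ->
  der v (fun y => f y + g y) x = der v f x + der v g x.
Proof.
by rewrite der.unlock => df dg; apply: deriveD; apply: diff_derivable;
  [exact: df|exact: dg].
Qed.

Lemma near_eq_der (f g : V -> W) (x v : V) :
  (\forall y \near x, f y = g y) -> der v f x = der v g x.
Proof. by rewrite der.unlock; exact: near_eq_derive. Qed.

Lemma der_cst (a : W) (x v : V) : der v (fun=> a) x = 0.
Proof. by rewrite der.unlock; exact: derive_cst. Qed.

Lemma derZ (a : R) (f : V -> W) (x v : V) :
  differentiable f x -> der v (fun y => a *: f y) x = a *: der v f x.
Proof. by rewrite der.unlock => df; apply: deriveZ; exact: diff_derivable. Qed.

Lemma derN (f : V -> W) (x v : V) :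
  differentiable f x -> der v (fun y => - f y) x = - der v f x.
Proof. by rewrite der.unlock => df; apply: deriveN; exact: diff_derivable. Qed.

Lemma derZv (a : R) (f : V -> W) (x v : V) :
  differentiable f x -> der (a *: v) f x = a *: der v f x.
Proof. by rewrite der.unlock => df; rewrite !deriveE // linearZ. Qed.

Lemma der_sumv (I : finType) (w : I -> V) (f : V -> W) (x : V) :
  differentiable f x -> der (\sum_i w i) f x = \sum_i der (w i) f x.
Proof.
rewrite der.unlock => df; rewrite deriveE // linear_sum.
by apply: eq_bigr => i _; rewrite deriveE.
Qed.

Lemma der_comp (U : normedModType R) (f : V -> W) (g : W -> U) (x v : V) :
  differentiable f x -> differentiable g (f x) ->
  der v (fun y => g (f y)) x = der (der v f x) g (f x).
Proof.
move=> df dg; rewrite der.unlock deriveE ?(deriveE _ df) ?(deriveE _ dg).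
  by rewrite (diff_comp df dg).
by apply: differentiable_comp; [exact: df|exact: dg].
Qed.

Lemma der_linear (f : V -> W) (x v : V) (flin : linear f) :
  continuous f -> der v f x = f v.
Proof.
rewrite der.unlock => fc; pose fM := GRing.isLinear.Build _ _ _ _ _ flin.
pose fL : {linear _ -> _} := HB.pack f fM.
rewrite -[f]/(fL : _ -> _) deriveE ?diff_lin //.
exact: linear_differentiable.
Qed.

End Calculus.

Section Matrices.
Context {R : realType} {V : normedModType R}.

Lemma derM (f g : V -> R) (x v : V) :
  differentiable f x -> differentiable g x ->
  der v (fun y => f y * g y) x = der v f x * g x + f x * der v g x.
Proof.
rewrite der.unlock => df dg; rewrite [LHS]deriveM; try exact: diff_derivable.
by rewrite addrC; congr (_ + _); exact: mulrC.
Qed.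

Lemma differentiable_entry m n (F : V -> 'M[R]_(m, n)) x i j :
  differentiable F x -> differentiable (fun y => F y i j) x.
Proof.
move=> dF; apply: (@differentiable_comp _ _ _ _ F (fun N : 'M[R]_(m, n) => N i j)) => //.
exact: differentiable_coord.
Qed.

Lemma differentiable_mxP m n (F : V -> 'M[R]_(m, n)) x :
  (forall i j, differentiable (fun y => F y i j) x) -> differentiable F x.
Proof.
move=> dF.
rewrite (_ : F = fun y => \sum_i \sum_j F y i j *: delta_mx i j).
  apply: differentiable_fsum => i; apply: differentiable_fsum => j.
  exact: differentiableZl.
by apply/funext => y; exact: matrix_sum_delta.
Qed.

Lemma der_entry m n (F : V -> 'M[R]_(m, n)) x v i j :
  differentiable F x -> der v F x i j = der v (fun y => F y i j) x.
Proof. by rewrite der.unlock => dF; rewrite derive_mx ?mxE //; apply: diff_derivable. Qed.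

Lemma differentiable_mulmx m n k (F : V -> 'M[R]_(m, n)) (G : V -> 'M[R]_(n, k)) x :
  differentiable F x -> differentiable G x ->
  differentiable (fun y => F y *m G y) x.
Proof.
move=> dF dG; apply: differentiable_mxP => i j.
under eq_fun do rewrite mxE.
apply: differentiable_fsum => l.
by apply: differentiableM; exact: differentiable_entry.
Qed.

Lemma der_mulmx m n k (F : V -> 'M[R]_(m, n)) (G : V -> 'M[R]_(n, k)) x v :
  differentiable F x -> differentiable G x ->
  der v (fun y => F y *m G y) x = der v F x *m G x + F x *m der v G x.
Proof.
move=> dF dG; apply/matrixP => i j.
rewrite der_entry; last exact: differentiable_mulmx.
under eq_fun do rewrite mxE.
rewrite der_fsum => [|l]; last first.
  by apply: differentiableM; exact: differentiable_entry.
rewrite !mxE -big_split /=; apply: eq_bigr => l _.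
by rewrite !der_entry // derM //; exact: differentiable_entry.
Qed.

Lemma differentiable_trmx m n (F : V -> 'M[R]_(m, n)) x :
  differentiable F x -> differentiable (fun y => (F y)^T) x.
Proof.
move=> dF; apply: differentiable_mxP => i j.
by under eq_fun do rewrite mxE; exact: differentiable_entry.
Qed.

Lemma der_trmx m n (F : V -> 'M[R]_(m, n)) x v :
  differentiable F x -> der v (fun y => (F y)^T) x = (der v F x)^T.
Proof.
move=> dF; apply/matrixP => i j.
rewrite der_entry; last exact: differentiable_trmx.
by rewrite mxE der_entry //; under eq_fun do rewrite mxE.
Qed.

Lemma differentiable_scalemx m n (f : V -> R) (F : V -> 'M[R]_(m, n)) x :
  differentiable f x -> differentiable F x ->
  differentiable (fun y => f y *: F y) x.
Proof.
move=> df dF; apply: differentiable_mxP => i j.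
under eq_fun do rewrite mxE.
by apply: differentiableM => //; exact: differentiable_entry.
Qed.

Lemma der_scalemx m n (f : V -> R) (F : V -> 'M[R]_(m, n)) x v :
  differentiable f x -> differentiable F x ->
  der v (fun y => f y *: F y) x = der v f x *: F x + f x *: der v F x.
Proof.
move=> df dF; apply/matrixP => i j.
rewrite der_entry; last exact: differentiable_scalemx.
under eq_fun do rewrite mxE.
by rewrite !mxE derM ?der_entry //; exact: differentiable_entry.
Qed.

Lemma differentiable_prod (I : finType) (f : I -> V -> R) x :
  (forall i, differentiable (f i) x) ->
  differentiable (fun y => \prod_i f i y) x.
Proof.
move=> df; rewrite -fct_prodE.
elim/big_ind: _ => [|f1 f2 d1 d2|i _]; first exact: differentiable_cst.
  by apply: differentiableM; [exact: d1|exact: d2].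
exact: df.
Qed.

Lemma differentiable_det n (F : V -> 'M[R]_n) x :
  differentiable F x -> differentiable (fun y => \det (F y)) x.
Proof.
move=> dF; apply: differentiable_fsum => s; apply: differentiableM => //.
by apply: differentiable_prod => i; exact: differentiable_entry.
Qed.

(** By Cramer's formula, locally the inverse is the adjugate divided by the
    determinant. *)
Lemma differentiable_invmx n (F : V -> 'M[R]_n) x :
  (\forall y \near x, F y \in unitmx) -> differentiable F x ->
  differentiable (fun y => invmx (F y)) x.
Proof.
move=> uF dF.
apply: (@near_eq_differentiable _ _ _ (fun y => (\det (F y))^-1 *: \adj (F y))).
  by apply: filterS uF => y; rewrite /invmx => ->.
apply: differentiable_mxP => i j.
under eq_fun do rewrite !mxE.
apply: differentiableM.
  apply: differentiableV; first exact: differentiable_det.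
  by have := nbhs_singleton uF; rewrite unitmxE unitfE.
apply: differentiableM => //; apply: differentiable_det.
apply: differentiable_mxP => k l.
by under eq_fun do rewrite !mxE; exact: differentiable_entry.
Qed.

End Matrices.

(** * Symmetry of second derivatives *)

Section SecondDerivatives.
Context {R : realType} {V : normedModType R}.
Implicit Types (f : V -> R) (x v w : V).

Lemma derive_line f v z t : differentiable f (t *: v + z) ->
  is_derive t 1 (fun s : R => f (s *: v + z)) ('D_v f (t *: v + z)).
Proof.
move=> df.
have dlv : differentiable (fun s : R => s *: v) t by exact: (@differentiableZl _ _ _ id v).
have dl : differentiable (fun s : R => s *: v + z) t.
  exact: (differentiableD dlv (differentiable_cst z t)).
apply: DeriveDef.
  by apply/diff_derivable; apply: (@differentiable_comp _ _ _ _ (fun s : R => s *: v + z) f).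
rewrite -!derE (@der_comp _ _ _ _ (fun s : R => s *: v + z) f) //.
congr (der _ f _); rewrite derD // der_cst addr0 der_linear ?scale1r //.
  by move=> a s s'; rewrite scalerDl scalerA.
exact: scalel_continuous.
Qed.

(** The mean value theorem in the direction [v] turns the second difference of [f]
    into a difference of [D_v f], which the differentiability of [D_v f] at [x]
    evaluates to first order. *)
Lemma second_difference f x v w :
  (\forall y \near x, differentiable f y) -> differentiable ('D_v f) x ->
  forall e : R, 0 < e -> \forall s \near 0^'+,
  `|f (s *: v + s *: w + x) - f (s *: v + x) - f (s *: w + x) + f x
    - s * s * 'D_w ('D_v f) x| <= e * (s * s).
Proof.
move=> df dg e e0; set g := 'D_v f.
have [dgc dgE] := (diff_locallyP _ _).1 dg.
pose N := `|v| + `|w| + 1.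
have N0 : 0 < N by rewrite /N; have := normr_ge0 v; have := normr_ge0 w; lra.
(* [D_v f] is expanded at two points within [s * N] of [x]: the two errors, of at
   most [e' * (s * N)] each, add up to [e * s]. *)
pose e' := e / (2 * N).
have e'0 : 0 < e' by apply: divr_gt0 => //; apply: mulr_gt0.
have near1 : \forall h \near (0 : V), `|g (h + x) - (g x + 'd g x h)| <= e' * `|h|.
  by move/eqaddoP : dgE => /(_ _ e'0).
have near2 : \forall h \near (0 : V), differentiable f (h + x).
  by move: df; rewrite (near_shift 0 x); apply: filterS => h; rewrite /= subr0.
have /nbhs_normP[/= d d0 dP] : \forall h \near (0 : V),
    `|g (h + x) - (g x + 'd g x h)| <= e' * `|h| /\ differentiable f (h + x).
  by near do split.
near=> s.
have s0 : 0 < s by near: s; exact: nbhs_right_gt.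
have sd : s * N < d.
  rewrite -ltr_pdivlMr //; near: s; apply: nbhs_right_lt.
  exact: divr_gt0.
have small (a b : R) : 0 <= a <= s -> 0 <= b <= s -> `|a *: v + b *: w| <= s * N.
  move=> /andP[a0 as_] /andP[b0 bs]; apply: (le_trans (ler_normD _ _)).
  rewrite !normrZ !ger0_norm //.
  have := ler_wpM2r (normr_ge0 v) as_; have := ler_wpM2r (normr_ge0 w) bs.
  rewrite /N; lra.
have inball (a b : R) : 0 <= a <= s -> 0 <= b <= s ->
    `|g (a *: v + b *: w + x) - (g x + 'd g x (a *: v + b *: w))| <= e' * (s * N)
    /\ differentiable f (a *: v + b *: w + x).
  move=> ha hb; have sm := small a b ha hb.
  have [] := dP (a *: v + b *: w).
    by rewrite /= sub0r normrN; apply: le_lt_trans sd.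
  move=> H1 H2; split=> //; apply: (le_trans H1); rewrite ler_wpM2l //; exact: ltW.
have hs : 0 <= s <= s by rewrite lexx ltW.
have h0 : 0 <= (0 : R) <= s by rewrite lexx ltW.
pose F t := f (t *: v + (s *: w + x)) - f (t *: v + (0 *: w + x)).
have dF t : 0 <= t <= s ->
    is_derive t 1 F (g (t *: v + (s *: w + x)) - g (t *: v + (0 *: w + x))).
  move=> ht; apply: is_deriveB; apply: derive_line; rewrite addrA.
    by have [] := inball t s ht hs.
  by have [] := inball t 0 ht h0.
have Fc : {within `[0, s], continuous F}.
  apply: derivable_within_continuous => t; rewrite in_itv /= => ht.
  by have [] := dF t ht.
have dF' t : t \in `]0, s[ ->
    is_derive t 1 F (g (t *: v + (s *: w + x)) - g (t *: v + (0 *: w + x))).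
  by rewrite in_itv /= => /andP[? ?]; apply: dF; rewrite !ltW.
have [c + cE] := MVT s0 dF' Fc.
rewrite in_itv /= => /andP[c0 cs].
have hc : 0 <= c <= s by rewrite !ltW.
have [I1 _] := inball c s hc hs.
have [I2 _] := inball c 0 hc h0.
move: I1 I2 cE; rewrite /F !scale0r !add0r !addr0 !subr0 !addrA => I1 I2 cE.
have -> : f (s *: v + s *: w + x) - f (s *: v + x) - f (s *: w + x) + f x
    = (g (c *: v + s *: w + x) - g (c *: v + x)) * s by rewrite -cE; ring.
have Dw : 'D_w g x = 'd g x w by rewrite deriveE.
have lin1 : 'd g x (c *: v + s *: w) = c * 'd g x v + s * 'd g x w.
  by rewrite linearD !linearZ.
have lin2 : 'd g x (c *: v) = c * 'd g x v by rewrite linearZ.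
move: I1 I2; rewrite Dw lin1 lin2.
set a1 := g (_ + s *: w + x); set a2 := g (_ + x); set b := 'd g x w.
set b' := 'd g x v => I1 I2.
have -> : (a1 - a2) * s - s * s * b = s * (a1 - a2 - s * b) by ring.
rewrite normrM (ger0_norm (ltW s0)) mulrCA ler_pM2l //.
have -> : e * s = e' * (s * N) + e' * (s * N).
  by rewrite /e'; field; rewrite gt_eqF.
move: I1 I2; rewrite !ler_norml; lra.
Unshelve. all: by end_near. Qed.

(** Young's theorem: the second difference is symmetric in [v] and [w]. *)
Lemma der_swap f x v w :
  (\forall y \near x, differentiable f y) ->
  differentiable (der v f) x -> differentiable (der w f) x ->
  der w (der v f) x = der v (der w f) x.
Proof.
rewrite der.unlock.
move=> df dv dw; apply/eqP; rewrite -subr_eq0 -normr_le0.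
apply/ler_addgt0Pr => e e0; rewrite add0r.
have e20 : 0 < e / 2 by apply: divr_gt0.
have H1 := @second_difference f x v w df dv _ e20.
have H2 := @second_difference f x w v df dw _ e20.
have [s [[I1 I2] s0]] := filter_ex (filterI (filterI H1 H2) (nbhs_right_gt (0 : R))).
rewrite -(ler_pM2r (mulr_gt0 s0 s0)).
have -> : `|'D_w ('D_v f) x - 'D_v ('D_w f) x| * (s * s) =
          `|s * s * 'D_w ('D_v f) x - s * s * 'D_v ('D_w f) x|.
  by rewrite -mulrBr normrM mulrC (ger0_norm (ltW (mulr_gt0 s0 s0))).
have E : f (s *: w + s *: v + x) = f (s *: v + s *: w + x).
  by congr (f (_ + x)); rewrite addrC.
move: I1 I2 E => /=; move: ('D_w ('D_v f) x) ('D_v ('D_w f) x) => a b.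
move: (f (s *: v + s *: w + x)) (f (s *: w + s *: v + x)) (f x).
move: (f (s *: v + x)) (f (s *: w + x)) => f1 f2 f3 f4 f5.
by rewrite !ler_norml => + + E; rewrite E; lra.
Qed.
End SecondDerivatives.

(** * Coordinate changes *)

Section Smooth.
Context {R : realType} {V : normedModType R} (U : set V).

Lemma smooth_differentiable (f : V -> R) x :
  smooth U f -> U x -> differentiable f x.
Proof. by move=> sf; have [+ _] := sf 1%N; exact. Qed.

Lemma smooth_der (f : V -> R) v : smooth U f -> smooth U (der v f).
Proof. by rewrite der.unlock => sf k; have [_] := sf k.+1; exact. Qed.

Lemma smooth_der_swap (f : V -> R) x v w : open U ->
  smooth U f -> U x -> der w (der v f) x = der v (der w f) x.
Proof.
move=> oU sf Ux; apply: der_swap.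
- have : nbhs x U by exact: open_nbhs_nbhs.
  by apply: filterS => y; exact: smooth_differentiable.
- exact: smooth_differentiable (smooth_der _ sf) Ux.
- exact: smooth_differentiable (smooth_der _ sf) Ux.
Qed.

End Smooth.

Section Charts.
Context {R : realType} {m : nat} {T : manifold R m}.
Implicit Types (c : chart T) (x : 'rV[R]_m).

Lemma overlapP c c' x : overlap c c' x <-> img c x /\ dom c' (pt c x).
Proof.
split=> [[y [cy c'y] <-]|[[y cy <-]]].
  by split; [exists y|rewrite cooK].
by rewrite cooK // => c'y; exists y.
Qed.

Lemma overlap_img c c' x : overlap c c' x -> img c x.
Proof. by case/overlapP. Qed.

Lemma overlap_open c c' : open (overlap c c').
Proof.
rewrite openE => x /overlapP[cx c'x].
have oi : open (img c) by exact: img_open.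
have ptc : {for x, continuous (pt c)}.
  have ptw : {within img c, continuous (pt c)} := @pt_continuous _ _ T c.
  by move: ptw; rewrite continuous_open_subspace //; apply; rewrite inE.
have n1 : nbhs x (img c) by exact: open_nbhs_nbhs.
have n2 : nbhs x (pt c @^-1` dom c').
  by apply: ptc; apply: open_nbhs_nbhs; split => //; exact: dom_open.
rewrite /interior /=; near=> y; apply/overlapP; split; near: y => //.
Unshelve. all: by end_near. Qed.

Lemma overlap_nbhs c c' x : overlap c c' x -> nbhs x (overlap c c').
Proof. by move=> ox; apply: open_nbhs_nbhs; split => //; exact: overlap_open. Qed.

Lemma img_nbhs c x : img c x -> nbhs x (img c).
Proof. by move=> ox; apply: open_nbhs_nbhs; split => //; exact: img_open. Qed.

Lemma overlap_trans c c' x : overlap c c' x -> overlap c' c (trans c c' x).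
Proof.
by move=> -[y [cy c'y] <-]; rewrite /trans cooK //; exists y.
Qed.

Lemma transK c c' x : overlap c c' x -> trans c' c (trans c c' x) = x.
Proof. by move=> -[y [cy c'y] <-]; rewrite /trans !cooK. Qed.

Lemma trans_differentiable c c' x : overlap c c' x -> differentiable (trans c c') x.
Proof.
move=> ox; apply: differentiable_mxP => i j; rewrite ord1.
exact: smooth_differentiable (transition_smooth c c' j) ox.
Qed.

Notation dlt k := (delta_mx 0 k).

Lemma jacE c c' x i j :
  jac c c' x i j = der (dlt j) (fun y => trans c c' y 0 i) x.
Proof. by rewrite mxE derE. Qed.

Lemma jac_differentiable c c' x : overlap c c' x -> differentiable (jac c c') x.
Proof.
move=> ox; apply: differentiable_mxP => i j.
under eq_fun do rewrite jacE.
exact: smooth_differentiable (smooth_der _ (transition_smooth c c' i)) ox.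
Qed.

Lemma der_trans c c' x v : overlap c c' x ->
  der v (trans c c') x = v *m (jac c c' x)^T.
Proof.
move=> ox; have d := trans_differentiable ox; rewrite derE deriveE //.
apply/rowP => j.
rewrite {1}(matrix_sum_delta v) big_ord1 linear_sum summxE [RHS]mxE /=.
apply: eq_bigr => k _; rewrite linearZ /= mxE [in RHS]mxE jacE -deriveE // -derE der_entry //.
Qed.

Lemma der_jac_entry c c' x v i j : overlap c c' x ->
  der v (jac c c') x i j = der v (der (dlt j) (fun y => trans c c' y 0 i)) x.
Proof.
move=> ox; rewrite der_entry; last exact: jac_differentiable.
by under eq_fun do rewrite jacE.
Qed.

Lemma der_jac_sym c c' x i j k : overlap c c' x ->
  der (dlt k) (jac c c') x i j = der (dlt j) (jac c c') x i k.
Proof.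
move=> ox; rewrite !der_jac_entry //.
exact: (@smooth_der_swap _ _ _ _ x _ _ (@overlap_open c c') (transition_smooth c c' i) ox).
Qed.

Lemma der_jac_differentiable c c' x v : overlap c c' x ->
  differentiable (der v (jac c c')) x.
Proof.
move=> ox; apply: differentiable_mxP => i j.
apply: (@near_eq_differentiable _ _ _ (der v (der (dlt j) (fun y => trans c c' y 0 i)))).
  by have := overlap_nbhs ox; apply: filterS => y oy; rewrite der_jac_entry.
apply: smooth_differentiable ox; do 2!apply: smooth_der.
exact: transition_smooth.
Qed.

Lemma der_jac_swap c c' x v w : overlap c c' x ->
  der w (der v (jac c c')) x = der v (der w (jac c c')) x.
Proof.
move=> ox; have E (v' w' : 'rV[R]_m) i j : der w' (der v' (jac c c')) x i j =
   der w' (der v' (der (dlt j) (fun y => trans c c' y 0 i))) x.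
  rewrite der_entry; last exact: der_jac_differentiable.
  apply: near_eq_der; have := overlap_nbhs ox.
  by apply: filterS => y oy; rewrite der_jac_entry.
apply/matrixP => i j; rewrite (E v w) (E w v).
exact: (@smooth_der_swap _ _ _ _ x _ _ (@overlap_open c c')
  (smooth_der _ (transition_smooth c c' i)) ox).
Qed.

(** Chain rule for [trans c' c] after [trans c c'], the identity near [x]. *)
Lemma jac_mulV c c' x : overlap c c' x ->
  jac c' c (trans c c' x) *m jac c c' x = 1%:M.
Proof.
move=> ox; apply/trmx_inj; rewrite trmx_mul trmx1; apply/row_matrixP => i.
rewrite !rowE mulmxA -(der_trans _ ox) -(der_trans _ (overlap_trans ox)).
rewrite -der_comp; [|exact: trans_differentiable|]; last first.
  by apply: trans_differentiable; exact: overlap_trans.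
rewrite mulmx1 -[RHS](@derive_id _ _ x) -derE; apply: near_eq_der.
by have := overlap_nbhs ox; apply: filterS => y oy; exact: transK.
Qed.

Lemma jac_mul c c' x : overlap c c' x ->
  jac c c' x *m jac c' c (trans c c' x) = 1%:M.
Proof. by move=> ox; apply: mulmx1C; exact: jac_mulV. Qed.

Lemma jac_unit c c' x : overlap c c' x -> jac c c' x \in unitmx.
Proof. by move=> ox; have [] := mulmx1_unit (jac_mul ox). Qed.

End Charts.

(** * Christoffel symbols *)

Section ChristoffelAlgebra.
Context {R : realType} {n : nat}.
Implicit Types (Q J : 'M[R]_n) (DQ K : 'I_n -> 'M[R]_n).

(** Twice the Christoffel symbols of the first kind, as the matrix with row [l] and
    column [j], when [DQ k] is the derivative of the metric in the direction [k]. *)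
Definition christoffel1 DQ k : 'M[R]_n :=
  \matrix_(l, j) (DQ k j l + DQ j k l - DQ l j k).

(** Christoffel symbols of the second kind, [Qi] being the inverse metric. The
    directions of derivation need not be coordinate ones: the coefficients [L] and [C]
    are of this form as well. *)
Definition christoffel2 Qi DQ k : 'M[R]_n := 2^-1 *: (Qi *m christoffel1 DQ k).

Lemma christoffel2_entry Qi DQ i j k :
  christoffel2 Qi DQ k i j = 2^-1 * \sum_l Qi i l * (DQ k j l + DQ j k l - DQ l j k).
Proof. by rewrite !mxE; congr (_ * _); apply: eq_bigr => l _; rewrite mxE. Qed.

Lemma christoffel2_sym Qi DQ i j k :
  (forall l, (DQ l)^T = DQ l) -> christoffel2 Qi DQ k i j = christoffel2 Qi DQ j i k.
Proof.
move=> sym; rewrite !christoffel2_entry; congr (_ * _); apply: eq_bigr => l _.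
congr (_ * _); rewrite [X in X - _]addrC; congr (_ - _).
by rewrite -[in RHS]sym mxE.
Qed.

Lemma congruence_entry (X Y : 'M[R]_n) (u : 'I_n -> R) DQ i j :
  (X^T *m (\sum_c u c *: DQ c) *m Y) i j =
  \sum_a \sum_b \sum_c X a i * Y b j * u c * DQ c a b.
Proof.
rewrite mxE exchange_big /=; apply: eq_bigr => b _.
rewrite mxE big_distrl /=; apply: eq_bigr => a _.
rewrite summxE mxE big_distrr big_distrl /=; apply: eq_bigr => c _.
by rewrite !mxE; ring.
Qed.

Lemma invmx_congruence Q' J : J \in unitmx -> Q' \in unitmx ->
  J *m invmx (J^T *m Q' *m J) *m J^T = invmx Q'.
Proof.
move=> uJ uQ'; have uJT : J^T \in unitmx by rewrite unitmx_tr.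
have uQ : J^T *m Q' *m J \in unitmx by rewrite !unitmx_mul uJT uQ' uJ.
have -> : invmx (J^T *m Q' *m J) = invmx J *m invmx Q' *m invmx J^T.
  rewrite -[LHS]mulmx1 -[RHS](mulKmx uQ); congr (_ *m _).
  by rewrite !mulmxA !mulmxK // mulmxV.
by rewrite !mulmxA mulmxV // mul1mx mulmxKV.
Qed.

(** The derivative of [Q = J^T Q' J] has three terms. With [E k j m] the term in which
    [J^T] is differentiated, the transposed term is [E k m j], and
    [E k j m + E k m j + E j k m + E j m k - E m j k - E m k j] reduces to
    [2 E k j m] as [E] is symmetric in its first two indices: this is the
    inhomogeneous term. *)
Lemma christoffel2_change Q Q' J DQ DQ' K :
  J \in unitmx -> Q' \in unitmx -> Q'^T = Q' -> Q = J^T *m Q' *m J ->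
  (forall i j k, K k i j = K j i k) ->
  (forall k, DQ k = (K k)^T *m Q' *m J + J^T *m (\sum_c J c k *: DQ' c) *m J
                    + J^T *m Q' *m K k) ->
  forall k, J *m christoffel2 (invmx Q) DQ k =
    (\sum_c J c k *: christoffel2 (invmx Q') DQ' c) *m J + K k.
Proof.
move=> uJ uQ' sQ' QE Ksym DQE k.
have lowE : christoffel1 DQ k =
    J^T *m (\sum_c J c k *: christoffel1 DQ' c) *m J + 2 *: (J^T *m Q' *m K k).
  apply/matrixP => l j.
  pose E k j m := ((K k)^T *m Q' *m J) j m.
  have Esym k' j' m' : E k' j' m' = E j' k' m'.
    rewrite /E -!mulmxA !mxE; apply: eq_bigr => a _.
    by rewrite ![(K _)^T _ _]mxE Ksym.
  have E2 k' j' m' : (J^T *m Q' *m K k') j' m' = E k' m' j'.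
    transitivity (((K k')^T *m Q' *m J)^T j' m'); last by rewrite mxE.
    by rewrite !trmx_mul trmxK sQ' mulmxA.
  pose T k j m := (J^T *m (\sum_c J c k *: DQ' c) *m J) j m.
  have DE k' j' m' : DQ k' j' m' = E k' j' m' + T k' j' m' + E k' m' j'.
    by rewrite DQE mxE E2 mxE.
  have TE : T k j l + T j k l - T l j k =
      (J^T *m (\sum_c J c k *: christoffel1 DQ' c) *m J) l j.
    rewrite /T !congruence_entry.
    have -> : \sum_a \sum_b \sum_c J a k * J b l * J c j * DQ' c a b =
        \sum_a \sum_b \sum_c J a j * J b l * J c k * DQ' a c b.
      rewrite [RHS]exchange_big [LHS]exchange_big /=; apply: eq_bigr => b _.
      rewrite exchange_big /=; apply: eq_bigr => a _.
      by apply: eq_bigr => c _; ring.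
    have -> : \sum_a \sum_b \sum_c J a j * J b k * J c l * DQ' c a b =
        \sum_a \sum_b \sum_c J a j * J b l * J c k * DQ' b a c.
      apply: eq_bigr => a _; rewrite exchange_big /=.
      by apply: eq_bigr => b _; apply: eq_bigr => c _; ring.
    rewrite [RHS]exchange_big -big_split -sumrB /=; apply: eq_bigr => a _.
    rewrite -big_split -sumrB /=; apply: eq_bigr => b _.
    rewrite -big_split -sumrB /=; apply: eq_bigr => c _.
    by rewrite [christoffel1 _ _ _ _]mxE; ring.
  rewrite mxE !DE [RHS]mxE [X in _ = _ + X]mxE E2 -TE.
  rewrite (Esym j k l) (Esym l j k) (Esym l k j).
  by ring.
rewrite /christoffel2 lowE -scalemxAr mulmxDr mulmxDr scalerDr QE; congr (_ + _).
  rewrite !mulmxA invmx_congruence // scalemxAl; congr (_ *m J).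
  rewrite mulmx_sumr scaler_sumr; apply: eq_bigr => c _.
  by rewrite -scalemxAr !scalerA mulrC.
rewrite -!scalemxAr scalerA mulVf ?pnatr_eq0 // scale1r !mulmxA.
by rewrite invmx_congruence // mulVmx // mul1mx.
Qed.
End ChristoffelAlgebra.

(** The symbols with fixed second lower index form the matrix of the connection in
    that direction; sealed like [der]. *)
HB.lock Definition christoffel_mx {R : realType} {n : nat} (q : 'rV[R]_n -> 'M[R]_n)
  (k : 'I_n) (x : 'rV[R]_n) : 'M[R]_n := \matrix_(i, j) christoffel q i j k x.

HB.lock Definition curvature_mx {R : realType} {n : nat} (q : 'rV[R]_n -> 'M[R]_n)
  (j k : 'I_n) (x : 'rV[R]_n) : 'M[R]_n := \matrix_(l, i) curvature q l i j k x.

Section SemiRiemannian.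
Context {R : realType} {m : nat} {T : manifold R m} (q : semi_riemannian T).
Implicit Types (c : chart T) (x v : 'rV[R]_m).
Notation dlt k := (delta_mx 0 k).

Lemma christoffelE (h : 'rV[R]_m -> 'M[R]_m) i j k x :
  christoffel h i j k x = christoffel_mx h k x i j.
Proof. by rewrite christoffel_mx.unlock mxE. Qed.

Lemma curvatureE (h : 'rV[R]_m -> 'M[R]_m) l i j k x :
  curvature h l i j k x = curvature_mx h j k x l i.
Proof. by rewrite curvature_mx.unlock mxE. Qed.

Lemma metric_differentiable c x : img c x -> differentiable (q c) x.
Proof.
move=> cx; apply: differentiable_mxP => i j.
exact: smooth_differentiable (metric_smooth q c i j) cx.
Qed.

Lemma der_metric_differentiable c x v : img c x -> differentiable (der v (q c)) x.
Proof.
move=> cx; apply: differentiable_mxP => i j.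
apply: (@near_eq_differentiable _ _ _ (der v (fun y => q c y i j))).
  apply: filterS (img_nbhs cx) => y cy.
  by rewrite der_entry //; exact: metric_differentiable.
exact: smooth_differentiable (smooth_der _ (metric_smooth q c i j)) cx.
Qed.

Lemma der_metric_sym c x v : img c x -> (der v (q c) x)^T = der v (q c) x.
Proof.
move=> cx; rewrite -der_trmx; last exact: metric_differentiable.
apply: near_eq_der.
by apply: filterS (img_nbhs cx) => y cy; rewrite (Defs.metric_sym q cy).
Qed.

Lemma christoffel_mxE c x k : img c x ->
  christoffel_mx (q c) k x = christoffel2 (invmx (q c x)) (fun l => der (dlt l) (q c) x) k.
Proof.
move=> cx; have dq := metric_differentiable cx.
apply/matrixP => i j; rewrite christoffel2_entry christoffel_mx.unlock mxE /christoffel.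
by congr (_ * _); apply: eq_bigr => l _; rewrite !der_entry // !derE.
Qed.

Lemma christoffel_mx_differentiable c x k :
  img c x -> differentiable (christoffel_mx (q c) k) x.
Proof.
move=> cx.
apply: (@near_eq_differentiable _ _ _
  (fun y => christoffel2 (invmx (q c y)) (fun l => der (dlt l) (q c) y) k)).
  by apply: filterS (img_nbhs cx) => y cy; rewrite christoffel_mxE.
apply: differentiable_scalemx; first exact: differentiable_cst.
apply: differentiable_mulmx.
  apply: differentiable_invmx; last exact: metric_differentiable.
  apply: filterS (img_nbhs cx) => y; exact: metric_nondegenerate.
apply: differentiable_mxP => i j; under eq_fun do rewrite mxE.
by apply: differentiableB; [apply: differentiableD|];
  apply: differentiable_entry; apply: der_metric_differentiable.
Qed.

Lemma christoffel_mx_sym c x i j k :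
  img c x -> christoffel_mx (q c) k x i j = christoffel_mx (q c) j x i k.
Proof.
move=> cx; rewrite !christoffel_mxE // christoffel2_sym // => l.
exact: der_metric_sym.
Qed.

Lemma metric_der_change c c' x k : overlap c c' x ->
  let J := jac c c' x in
  der (dlt k) (q c) x = (der (dlt k) (jac c c') x)^T *m q c' (trans c c' x) *m J
    + J^T *m (\sum_l J l k *: der (dlt l) (q c') (trans c c' x)) *m J
    + J^T *m q c' (trans c c' x) *m der (dlt k) (jac c c') x.
Proof.
move=> ox J.
have ox' := overlap_img (overlap_trans ox).
have dJ := jac_differentiable ox; have dt := trans_differentiable ox.
have dq := metric_differentiable ox'.
have dqt : differentiable (fun y => q c' (trans c c' y)) x.
  exact: differentiable_comp.
rewrite (_ : der _ _ _ = der (dlt k)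
  (fun y => (jac c c' y)^T *m q c' (trans c c' y) *m jac c c' y) x); last first.
  by apply: near_eq_der; apply: filterS (overlap_nbhs ox) => y; exact: metric_change.
have dJT := differentiable_trmx dJ.
rewrite der_mulmx //; last exact: differentiable_mulmx.
rewrite der_mulmx // der_trmx // mulmxDl; congr (_ *m _ *m _ + _ *m _ *m _ + _).
rewrite (@der_comp _ _ _ _ (trans c c') (q c')) // der_trans //.
rewrite -rowE [row _ _]row_sum_delta der_sumv //; apply: eq_bigr => l _.
by rewrite derZv // !mxE.
Qed.

Lemma christoffel_mx_change c c' x k : overlap c c' x ->
  jac c c' x *m christoffel_mx (q c) k x =
  (\sum_l jac c c' x l k *: christoffel_mx (q c') l (trans c c' x)) *m jac c c' x
  + der (dlt k) (jac c c') x.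
Proof.
move=> ox; have ox' := overlap_img (overlap_trans ox).
rewrite christoffel_mxE; last exact: overlap_img ox.
under [in RHS]eq_bigr do rewrite christoffel_mxE //.
apply: (@christoffel2_change _ _ _ _ _ (fun l => der (dlt l) (q c) x)
  (fun l => der (dlt l) (q c') (trans c c' x)) (fun l => der (dlt l) (jac c c') x)
  (jac_unit ox) (metric_nondegenerate q ox') (Defs.metric_sym q ox')
  (metric_change q ox)).
- by move=> i j l; exact: der_jac_sym.
- by move=> l; exact: metric_der_change.
Qed.

Lemma curvature_mxE c x j k : img c x ->
  curvature_mx (q c) j k x =
    der (dlt k) (christoffel_mx (q c) j) x - der (dlt j) (christoffel_mx (q c) k) x
    + (christoffel_mx (q c) k x *m christoffel_mx (q c) j x
       - christoffel_mx (q c) j x *m christoffel_mx (q c) k x).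
Proof.
move=> cx; apply/matrixP => l i; rewrite curvature_mx.unlock !mxE /curvature.
rewrite -sumrB !der_entry; try exact: christoffel_mx_differentiable.
rewrite -!derE; congr (_ - _ + _).
- by congr (der _ _ _); apply/funext => y; rewrite christoffelE.
- by congr (der _ _ _); apply/funext => y; rewrite christoffelE.
by apply: eq_bigr => s _; rewrite !christoffelE; congr (_ - _); rewrite mulrC.
Qed.
End SemiRiemannian.

(** * Curvature *)

Section Curvature.
Context {R : realType} {m : nat} {T : manifold R m} (q : semi_riemannian T).
Implicit Types (c : chart T) (x v : 'rV[R]_m).
Notation dlt k := (delta_mx 0 k).

(** [A_k = J G_k - P_k J] says that [J], with derivatives [A_k], intertwines the
    connections [G] and [P]; then it intertwines their curvatures. The second
    derivative [S] of [J] occurs in both directions and cancels. *)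
Lemma curvature_gauge n (J G1 G2 P1 P2 A1 A2 dG1 dG2 dP1 dP2 S : 'M[R]_n) :
  A1 = J *m G1 - P1 *m J -> A2 = J *m G2 - P2 *m J ->
  A2 *m G1 + J *m dG1 = dP1 *m J + P1 *m A2 + S ->
  A1 *m G2 + J *m dG2 = dP2 *m J + P2 *m A1 + S ->
  J *m (dG1 - dG2 + (G2 *m G1 - G1 *m G2)) =
  (dP1 - dP2 + (P2 *m P1 - P1 *m P2)) *m J.
Proof.
move=> -> -> /(canRL (addKr _)) E1 /(canRL (addKr _)) E2.
rewrite !(mulmxDr, mulmxDl, mulmxN, mulNmx) E1 E2.
rewrite !(mulmxDr, mulmxDl, mulmxN, mulNmx) !mulmxA.
move: (J *m G2 *m G1) (J *m G1 *m G2) (P2 *m J *m G1) (P1 *m J *m G2).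
move: (dP1 *m J) (dP2 *m J) (P1 *m P2 *m J) (P2 *m P1 *m J) => X1 X2 X3 X4 X5 X6 X7 X8.
by apply/matrixP => i j; rewrite !mxE; ring.
Qed.

(** The pulled back connection [P k] has the curvature given by the right-hand side,
    since the derivative of [J] is symmetric in the two lower indices. *)
Lemma curvature_mx_change c c' x j k : overlap c c' x -> let J := jac c c' x in
  J *m curvature_mx (q c) j k x =
  (\sum_a \sum_b (J a j * J b k) *: curvature_mx (q c') a b (trans c c' x)) *m J.
Proof.
move=> ox J; have cx := overlap_img ox; have ox' := overlap_img (overlap_trans ox).
have dJ := jac_differentiable ox; have dt := trans_differentiable ox.
pose G := christoffel_mx (q c); pose G' := christoffel_mx (q c').
pose P l y := \sum_a jac c c' y a l *: G' a (trans c c' y).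
pose A l := der (dlt l) (jac c c') x.
have dGt a : differentiable (fun y => G' a (trans c c' y)) x.
  by apply: differentiable_comp => //; exact: christoffel_mx_differentiable.
have dterm a l : differentiable (fun y => jac c c' y a l *: G' a (trans c c' y)) x.
  by apply: differentiable_scalemx => //; exact: differentiable_entry.
have dP l : differentiable (P l) x by exact: differentiable_fsum.
have derP l k' : der (dlt k') (P l) x =
    \sum_a (A k' a l *: G' a (trans c c' x) +
      J a l *: \sum_b J b k' *: der (dlt b) (G' a) (trans c c' x)).
  rewrite der_fsum //; apply: eq_bigr => a _.
  rewrite der_scalemx //; last exact: differentiable_entry.
  rewrite -der_entry //; congr (_ + _ *: _).
  have dG' := christoffel_mx_differentiable q a ox'.
  rewrite (@der_comp _ _ _ _ (trans c c') (G' a)) // der_trans //.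
  rewrite -rowE [row _ _]row_sum_delta der_sumv //; apply: eq_bigr => b _.
  by rewrite derZv // !mxE.
have lawA l : A l = J *m G l x - P l x *m J.
  by rewrite christoffel_mx_change // addrC addKr.
have lawD l k' : A k' *m G l x + J *m der (dlt k') (G l) x =
    der (dlt k') (P l) x *m J + P l x *m A k' + der (dlt k') (der (dlt l) (jac c c')) x.
  have dG := christoffel_mx_differentiable q l cx.
  rewrite /A /J -!der_mulmx // -derD; last 2 first.
  - exact: differentiable_mulmx.
  - exact: der_jac_differentiable.
  apply: near_eq_der; apply: filterS (overlap_nbhs ox) => y oy.
  exact: christoffel_mx_change.
rewrite curvature_mxE // -/G.
have swapped := lawD k j; rewrite (der_jac_swap _ _ ox) in swapped.
rewrite (curvature_gauge (lawA j) (lawA k) (lawD j k) swapped).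
congr (_ *m _); rewrite !derP -sumrB.
have -> : P k x *m P j x = \sum_a \sum_b (J a j * J b k) *:
     (G' b (trans c c' x) *m G' a (trans c c' x)).
  rewrite mulmx_sumr; apply: eq_bigr => a _; rewrite mulmx_suml; apply: eq_bigr => b _.
  by rewrite -scalemxAl -scalemxAr scalerA mulrC.
have -> : P j x *m P k x = \sum_a \sum_b (J a j * J b k) *:
     (G' a (trans c c' x) *m G' b (trans c c' x)).
  rewrite mulmx_suml; apply: eq_bigr => a _; rewrite mulmx_sumr; apply: eq_bigr => b _.
  by rewrite -scalemxAl -scalemxAr scalerA.
under [RHS]eq_bigr => a _ do under eq_bigr => b _ do rewrite curvature_mxE //.
have -> : \sum_a (A k a j *: G' a (trans c c' x) +
      J a j *: (\sum_b J b k *: der (dlt b) (G' a) (trans c c' x)) -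
     (A j a k *: G' a (trans c c' x) +
      J a k *: (\sum_b J b j *: der (dlt b) (G' a) (trans c c' x)))) =
   \sum_a \sum_b (J a j * J b k) *: der (dlt b) (G' a) (trans c c' x)
   - \sum_a \sum_b (J a j * J b k) *: der (dlt a) (G' b) (trans c c' x).
  rewrite [X in _ - X]exchange_big -sumrB /=; apply: eq_bigr => a _.
  rewrite /A (der_jac_sym _ _ _ ox) opprD addrACA subrr add0r.
  by congr (_ - _); rewrite scaler_sumr; apply: eq_bigr => b _; rewrite scalerA // mulrC.
rewrite -!sumrB -big_split /=; apply: eq_bigr => a _.
rewrite -!sumrB -big_split /=; apply: eq_bigr => b _.
by rewrite -!scalerBr -scalerDr.
Qed.
End Curvature.

(** * The torsion as a bilinear form *)

Section Linear.
Context {R : realType} {V W : normedModType R}.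

Lemma differentiable_linear (f : V -> W) (x : V) (flin : linear f) :
  continuous f -> differentiable f x.
Proof.
move=> fc; pose fM := GRing.isLinear.Build _ _ _ _ _ flin.
pose fL : {linear _ -> _} := HB.pack f fM.
by rewrite -[f]/(fL : _ -> _); exact: linear_differentiable.
Qed.

Lemma linearf_sum (K : finType) (f : V -> W) (v : K -> V) :
  linear f -> f (\sum_k v k) = \sum_k f (v k).
Proof.
move=> flin; pose fM := GRing.isLinear.Build _ _ _ _ _ flin.
pose fL : {linear _ -> _} := HB.pack f fM.
by rewrite -[f]/(fL : _ -> _) linear_sum.
Qed.

Lemma linearfZ (f : V -> W) (r : R) (x : V) : linear f -> f (r *: x) = r *: f x.
Proof.
move=> flin; pose fM := GRing.isLinear.Build _ _ _ _ _ flin.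
pose fL : {linear _ -> _} := HB.pack f fM.
by rewrite -[f]/(fL : _ -> _) linearZ.
Qed.

Lemma linearfB (f : V -> W) (x y : V) : linear f -> f (x - y) = f x - f y.
Proof.
move=> flin; pose fM := GRing.isLinear.Build _ _ _ _ _ flin.
pose fL : {linear _ -> _} := HB.pack f fM.
by rewrite -[f]/(fL : _ -> _) linearB.
Qed.

End Linear.

Section Products.
Context {R : realType} {U V W : normedModType R}.

Lemma fst_linear : linear (fst : V * W -> V). Proof. by []. Qed.
Lemma snd_linear : linear (snd : V * W -> W). Proof. by []. Qed.

Lemma fst_continuous : continuous (fst : V * W -> V).
Proof. by move=> x; exact: cvg_fst. Qed.

Lemma snd_continuous : continuous (snd : V * W -> W).
Proof. by move=> x; exact: cvg_snd. Qed.

Lemma differentiable_fst (f : U -> V * W) x :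
  differentiable f x -> differentiable (fun y => (f y).1) x.
Proof.
move=> df; apply: (@differentiable_comp _ _ _ _ f fst) => //.
exact: differentiable_linear fst_linear fst_continuous.
Qed.

Lemma differentiable_snd (f : U -> V * W) x :
  differentiable f x -> differentiable (fun y => (f y).2) x.
Proof.
move=> df; apply: (@differentiable_comp _ _ _ _ f snd) => //.
exact: differentiable_linear snd_linear snd_continuous.
Qed.

Lemma der_fst (f : U -> V * W) x v :
  differentiable f x -> der v (fun y => (f y).1) x = (der v f x).1.
Proof.
move=> df; rewrite (@der_comp _ _ _ _ f fst) //.
  exact: der_linear fst_linear fst_continuous.
exact: differentiable_linear fst_linear fst_continuous.
Qed.

Lemma der_snd (f : U -> V * W) x v :
  differentiable f x -> der v (fun y => (f y).2) x = (der v f x).2.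
Proof.
move=> df; rewrite (@der_comp _ _ _ _ f snd) //.
  exact: der_linear snd_linear snd_continuous.
exact: differentiable_linear snd_linear snd_continuous.
Qed.

Lemma der_pair (f : U -> V) (g : U -> W) x v :
  differentiable f x -> differentiable g x ->
  der v (fun y => (f y, g y)) x = (der v f x, der v g x).
Proof.
move=> df dg; have dp := differentiable_pair df dg.
by apply: injective_projections => /=; rewrite -?der_fst -?der_snd.
Qed.

Lemma fst_sum (I : finType) (f : I -> V * W) : (\sum_i f i).1 = \sum_i (f i).1.
Proof. by elim/big_rec2: _ => // i y1 y2 _ <-. Qed.

Lemma snd_sum (I : finType) (f : I -> V * W) : (\sum_i f i).2 = \sum_i (f i).2.
Proof. by elim/big_rec2: _ => // i y1 y2 _ <-. Qed.

End Products.

Section Identity.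
Context {R : realType} {V : normedModType R}.

Lemma differentiable_idf (x : V) : differentiable (fun y => y) x.
Proof. by apply: differentiable_linear => // y; exact: cvg_id. Qed.

Lemma der_idf (x v : V) : der v (fun y => y) x = v.
Proof. by rewrite derE; exact: derive_id. Qed.

End Identity.

Lemma sum_delta (R : realType) m n (F : 'I_m -> 'I_n -> R) :
  \sum_i \sum_j F i j *: delta_mx i j = \matrix_(i, j) F i j.
Proof.
rewrite [RHS]matrix_sum_delta; apply: eq_bigr => i _; apply: eq_bigr => j _.
by rewrite mxE.
Qed.

Section AdaptedFrame.
Context {R : realType} {p n : nat} (S : local_data R p n).
Notation J := (jet R p n).
Notation I := (idx p n).
Implicit Types (u w x y : J) (a b e : I).

Lemma sum_idx (V : zmodType) (F : I -> V) :
  \sum_e F e = \sum_al F (IT al) + \sum_i F (IX i) + \sum_i \sum_al F (IV i al).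
Proof.
by rewrite !big_sumType /= pair_bigA; congr (_ + _); apply: eq_bigr => -[].
Qed.

Lemma coframe_linear e w : linear (coframe S e w).
Proof.
move=> r x y; case: e => [[al|i]|[i al]] /=; rewrite !mxE //.
under eq_bigr do rewrite !mxE mulrDr mulrCA.
under [X in _ + X = _]eq_bigr do rewrite !mxE mulrDr mulrCA.
rewrite !big_split /= -!mulr_sumr /GRing.scale /=; ring.
Qed.

Lemma coframe_sum (K : finType) (v : K -> J) e w :
  coframe S e w (\sum_k v k) = \sum_k coframe S e w (v k).
Proof. exact: linearf_sum (coframe_linear e w). Qed.

Lemma coframeZ r e w x : coframe S e w (r *: x) = r * coframe S e w x.
Proof. exact: linearfZ (coframe_linear e w). Qed.

Lemma coframeB e w x y : coframe S e w (x - y) = coframe S e w x - coframe S e w y.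
Proof. exact: linearfB (coframe_linear e w). Qed.

Lemma frame_coframe w x : x = \sum_e coframe S e w x *: frame S e w.
Proof.
rewrite sum_idx; apply: injective_projections; first apply: injective_projections.
- rewrite /= !fst_sum /= [X in _ + X]big1 => [|i _]; last first.
    by rewrite !fst_sum big1 // => al _; rewrite /= scaler0.
  rewrite [X in _ + X + _]big1 => [|i _]; last by rewrite /= scaler0.
  by rewrite !addr0 [LHS]row_sum_delta.
- rewrite /= !fst_sum /= !snd_sum [X in _ + X]big1 => [|i _]; last first.
    by rewrite !fst_sum snd_sum big1 // => al _; rewrite /= scaler0.
  rewrite [X in X + _ + _]big1 => [|i _]; last by rewrite /= scaler0.
  by rewrite addr0 add0r [LHS]row_sum_delta.
rewrite /= !snd_sum /=; under [X in _ + X]eq_bigr do rewrite snd_sum /=.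
apply/matrixP => k mu; rewrite !mxE !summxE.
under eq_bigr do rewrite !mxE.
under [X in _ + X + _]eq_bigr do rewrite !mxE.
rewrite [X in _ + X](_ : _ = coframe S (IV k mu) w x).
  under eq_bigr do rewrite mulrN mulrC.
  under [X in _ + X + _]eq_bigr do rewrite mulrN mulrC.
  by rewrite /= !sumrN; ring.
by rewrite -summxE (sum_delta (fun i al => coframe S (IV i al) w x)) mxE.
Qed.

Lemma coframe_frame e b w : coframe S e w (frame S b w) = (e == b)%:R.
Proof.
case: e => [[al|i]|[i al]]; case: b => [[be|j]|[j be]]; rewrite /= ?mxE ?eqxx //=.
- rewrite (bigD1 be) //= mxE !eqxx mulr1 big1 => [|k ne]; last first.
    by rewrite mxE (negPf ne) andbF mulr0.
  by rewrite big1 => [|k _]; rewrite ?mxE ?mulr0 // !addr0 addNr.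
- rewrite big1 => [|k _]; last by rewrite mxE mulr0.
  rewrite (bigD1 j) //= mxE !eqxx mulr1 big1 => [|k ne]; last first.
    by rewrite mxE (negPf ne) andbF mulr0.
  by rewrite !addr0 addNr.
- rewrite big1 => [|k _]; last by rewrite mxE mulr0.
  by rewrite big1 => [|k _]; rewrite ?mxE ?mulr0 // !addr0.
Qed.

End AdaptedFrame.

Section TorsionForm.
Context {R : realType} {p n : nat} (S : local_data R p n) (u : jet R p n).
Notation J := (jet R p n).
Notation I := (idx p n).
Implicit Types (w x y : J) (a b e : I).
Hypothesis dM : forall i al be, differentiable (Mcon S i al be) u.
Hypothesis dN : forall i al j, differentiable (Ncon S i al j) u.

(** The first two terms are the exterior derivative of the coframe, for vectors [x]
    and [y] with constant coordinates. *)
Definition torsion_form e x y : R :=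
  der x (fun w => coframe S e w y) u - der y (fun w => coframe S e w x) u
  + \sum_a \sum_b coframe S a u x * coframe S b u y
                  * (cartan S a b e u - cartan S b a e u).

Lemma differentiable_coframe e (Y : J -> J) : differentiable Y u ->
  differentiable (fun w => coframe S e w (Y w)) u.
Proof.
move=> dY; have dY1 := differentiable_fst dY.
have dY2 i al := differentiable_entry i al (differentiable_snd dY).
have dY11 al := differentiable_entry 0 al (differentiable_fst dY1).
have dY12 i := differentiable_entry 0 i (differentiable_snd dY1).
case: e => [[al|i]|[i al]] //=.
apply: differentiableD; first apply: differentiableD => //.
  by apply: differentiable_fsum => be; exact: differentiableM.
by apply: differentiable_fsum => be; exact: differentiableM.
Qed.

Lemma der_coframe_cst i al x y :
  der x (fun w => coframe S (IV i al) w y) u =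
  \sum_be der x (Mcon S i al be) u * y.1.1 0 be
  + \sum_j der x (Ncon S i al j) u * y.1.2 0 j.
Proof.
have dMy be : differentiable (fun w => Mcon S i al be w * y.1.1 0 be) u.
  by apply: differentiableM.
have dNy j : differentiable (fun w => Ncon S i al j w * y.1.2 0 j) u.
  by apply: differentiableM.
rewrite /= derD; last 2 first.
- by apply: differentiableD => //; exact: differentiable_fsum.
- exact: differentiable_fsum.
rewrite derD //; last exact: differentiable_fsum.
rewrite der_cst add0r !der_fsum //; congr (_ + _); apply: eq_bigr => k _.
  by rewrite derM // der_cst mulr0 addr0.
by rewrite derM // der_cst mulr0 addr0.
Qed.

Lemma der_coframe e x (Y : J -> J) : differentiable Y u ->
  der x (fun w => coframe S e w (Y w)) u =
  coframe S e u (der x Y u) + der x (fun w => coframe S e w (Y u)) u.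
Proof.
move=> dY; have dY1 := differentiable_fst dY.
have dY2 i al := differentiable_entry i al (differentiable_snd dY).
have dY11 al := differentiable_entry 0 al (differentiable_fst dY1).
have dY12 i := differentiable_entry 0 i (differentiable_snd dY1).
have D11 al : der x (fun w => (Y w).1.1 0 al) u = (der x Y u).1.1 0 al.
  by rewrite -der_fst // -der_fst // der_entry //; exact: differentiable_fst.
have D12 i : der x (fun w => (Y w).1.2 0 i) u = (der x Y u).1.2 0 i.
  by rewrite -der_fst // -der_snd // der_entry //; exact: differentiable_snd.
have D2 i al : der x (fun w => (Y w).2 i al) u = (der x Y u).2 i al.
  by rewrite -der_snd // der_entry //; exact: differentiable_snd.
case: e => [[al|i]|[i al]].
- by rewrite /= D11 der_cst addr0.
- by rewrite /= D12 der_cst addr0.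
rewrite der_coframe_cst /=.
have dMy be : differentiable (fun w => Mcon S i al be w * (Y w).1.1 0 be) u.
  by apply: differentiableM.
have dNy j : differentiable (fun w => Ncon S i al j w * (Y w).1.2 0 j) u.
  by apply: differentiableM.
rewrite derD; last 2 first.
- by apply: differentiableD => //; exact: differentiable_fsum.
- exact: differentiable_fsum.
rewrite derD //; last exact: differentiable_fsum.
rewrite D2 !der_fsum //.
rewrite (eq_bigr (fun be => der x (Mcon S i al be) u * (Y u).1.1 0 be
  + Mcon S i al be u * (der x Y u).1.1 0 be)); last by move=> be _; rewrite derM // D11.
rewrite [X in _ + X = _](eq_bigr (fun j => der x (Ncon S i al j) u * (Y u).1.2 0 j
  + Ncon S i al j u * (der x Y u).1.2 0 j)); last by move=> j _; rewrite derM // D12.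
rewrite !big_split /=.
set s1 := \sum_i0 _; set s2 := \sum_i0 _; set s3 := \sum_i0 _; set s4 := \sum_i0 _.
by ring.
Qed.

(** The derivative of [theta_e Y] along [X] is [theta_e] of the derivative of [Y] plus
    the derivative of [theta_e] on the value of [Y]; the first parts make up [theta_e]
    of the bracket. *)
Lemma torsion_formP (X Y : J -> J) : differentiable X u -> differentiable Y u ->
  torsion S X Y u = \sum_e torsion_form e (X u) (Y u) *: frame S e u.
Proof.
move=> dX dY.
pose cc e x y := \sum_a \sum_b coframe S a u x * coframe S b u y * cartan S a b e u.
have -> : torsion S X Y u =
    \sum_e (der (X u) (fun w => coframe S e w (Y w)) u + cc e (X u) (Y u)) *: frame S e u
  - \sum_e (der (Y u) (fun w => coframe S e w (X w)) u + cc e (Y u) (X u)) *: frame S e u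
  - (der (X u) Y u - der (Y u) X u) by rewrite der.unlock.
rewrite [X in _ - _ - X](frame_coframe S u) -!sumrB; apply: eq_bigr => e _.
rewrite -!scalerBl; congr (_ *: _).
rewrite /torsion_form coframeB (der_coframe _ _ dX) (der_coframe _ _ dY).
have -> : \sum_a \sum_b coframe S a u (X u) * coframe S b u (Y u)
      * (cartan S a b e u - cartan S b a e u) = cc e (X u) (Y u) - cc e (Y u) (X u).
  rewrite /cc [X in _ - X]exchange_big -sumrB /=; apply: eq_bigr => a _.
  by rewrite -sumrB; apply: eq_bigr => b _; ring.
by ring.
Qed.

Lemma torsion_form_antisym e x y : torsion_form e x y = - torsion_form e y x.
Proof.
rewrite /torsion_form opprD opprB; congr (_ + _).
rewrite exchange_big -sumrN; apply: eq_bigr => a _.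
by rewrite -sumrN; apply: eq_bigr => b _; ring.
Qed.

Lemma torsion_form_suml (K : finType) (k : K -> R) (v : K -> J) e y :
  torsion_form e (\sum_i k i *: v i) y = \sum_i k i * torsion_form e (v i) y.
Proof.
have dcst z : differentiable (fun w => coframe S e w z) u.
  exact: (differentiable_coframe _ (differentiable_cst z u)).
rewrite /torsion_form der_sumv //.
have -> : der y (fun w => coframe S e w (\sum_i k i *: v i)) u =
    \sum_i k i * der y (fun w => coframe S e w (v i)) u.
  rewrite (_ : (fun _ => _) = fun w => \sum_i k i *: coframe S e w (v i)).
    by rewrite der_fsum => [|i]; [apply: eq_bigr => i _; exact: derZ|exact: differentiableZ].
  by apply/funext => w; rewrite coframe_sum; apply: eq_bigr => i _; rewrite coframeZ.
have -> : \sum_a \sum_b coframe S a u (\sum_i k i *: v i) * coframe S b u y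
      * (cartan S a b e u - cartan S b a e u) =
    \sum_i k i * \sum_a \sum_b coframe S a u (v i) * coframe S b u y
      * (cartan S a b e u - cartan S b a e u).
  under eq_bigr do rewrite coframe_sum.
  under [RHS]eq_bigr do rewrite mulr_sumr.
  rewrite [RHS]exchange_big; apply: eq_bigr => a _.
  under [RHS]eq_bigr do rewrite mulr_sumr.
  rewrite [RHS]exchange_big; apply: eq_bigr => b _.
  by rewrite !mulr_suml; apply: eq_bigr => i _; rewrite coframeZ; ring.
rewrite -sumrB -big_split /=; apply: eq_bigr => i _.
by rewrite derZv // /GRing.scale /=; ring.
Qed.

Lemma torsion_form_sumr (K : finType) (k : K -> R) (v : K -> J) e x :
  torsion_form e x (\sum_i k i *: v i) = \sum_i k i * torsion_form e x (v i).
Proof.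
rewrite torsion_form_antisym torsion_form_suml -sumrN; apply: eq_bigr => i _.
by rewrite [in RHS]torsion_form_antisym mulrN.
Qed.

Hypothesis dF : forall a, differentiable (frame S a) u.

Lemma torsion_frame a b :
  torsion S (frame S a) (frame S b) u =
  \sum_e torsion_form e (frame S a u) (frame S b u) *: frame S e u.
Proof. exact: torsion_formP. Qed.

Lemma torsion_compE a b e :
  torsion_comp S a b e u = torsion_form e (frame S a u) (frame S b u).
Proof.
rewrite /torsion_comp torsion_frame coframe_sum (bigD1 e) //= coframeZ.
rewrite coframe_frame eqxx mulr1 big1 ?addr0 // => f fe.
by rewrite coframeZ coframe_frame eq_sym (negPf fe) mulr0.
Qed.

Lemma torsion_frame_expand (X Y : J -> J) : differentiable X u -> differentiable Y u ->
  torsion S X Y u = \sum_a \sum_b (coframe S a u (X u) * coframe S b u (Y u))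
                                  *: torsion S (frame S a) (frame S b) u.
Proof.
move=> dX dY; rewrite torsion_formP //.
transitivity (\sum_e \sum_a \sum_b (coframe S a u (X u) * coframe S b u (Y u))
    *: (torsion_form e (frame S a u) (frame S b u) *: frame S e u)).
  apply: eq_bigr => e _.
  rewrite {1}[X u](frame_coframe S u) {1}[Y u](frame_coframe S u).
  rewrite torsion_form_suml scaler_suml; apply: eq_bigr => a _.
  rewrite torsion_form_sumr mulr_sumr scaler_suml; apply: eq_bigr => b _.
  by rewrite scalerA mulrA.
rewrite exchange_big; apply: eq_bigr => a _.
rewrite exchange_big; apply: eq_bigr => b _.
by rewrite torsion_frame scaler_sumr.
Qed.

Lemma torsion_form_frame e a b :
  torsion_form e (frame S a u) (frame S b u) =
  der (frame S a u) (fun w => coframe S e w (frame S b u)) u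
  - der (frame S b u) (fun w => coframe S e w (frame S a u)) u
  + (cartan S a b e u - cartan S b a e u).
Proof.
rewrite /torsion_form; congr (_ + _).
rewrite (bigD1 a) //= (bigD1 b) //= !coframe_frame !eqxx !mul1r.
rewrite big1 => [|b' nb]; last by rewrite !coframe_frame (negPf nb) mulr0 mul0r.
rewrite big1 ?addr0 // => a' na; apply: big1 => b' _.
by rewrite coframe_frame (negPf na) !mul0r.
Qed.

Lemma torsion_comp_hor a b (e : 'I_p + 'I_n) :
  torsion_comp S a b (inl e) u = cartan S a b (inl e) u - cartan S b a (inl e) u.
Proof.
by rewrite torsion_compE torsion_form_frame; case: e => e /=; rewrite !der_cst subrr add0r.
Qed.

Lemma torsion_comp_vert a b i al :
  torsion_comp S a b (IV i al) u =
  (match b with IT be => der (frame S a u) (Mcon S i al be) u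
           | IX j => der (frame S a u) (Ncon S i al j) u | IV _ _ => 0 end
  - match a with IT be => der (frame S b u) (Mcon S i al be) u
           | IX j => der (frame S b u) (Ncon S i al j) u | IV _ _ => 0 end)
  + (cartan S a b (IV i al) u - cartan S b a (IV i al) u).
Proof.
have E x b' : der x (fun w => coframe S (IV i al) w (frame S b' u)) u =
   match b' with IT be => der x (Mcon S i al be) u
           | IX j => der x (Ncon S i al j) u | IV _ _ => 0 end.
  rewrite der_coframe_cst; case: b' => [[be|j]|[j be]] /=.
  - rewrite (bigD1 be) //= mxE !eqxx mulr1 !big1 ?addr0 // => k ne.
      by rewrite mxE mulr0.
    by rewrite mxE (negPf ne) andbF mulr0.
  - rewrite big1 ?add0r => [|k _]; last by rewrite mxE mulr0.
    rewrite (bigD1 j) //= mxE !eqxx mulr1 big1 ?addr0 // => k ne.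
    by rewrite mxE (negPf ne) andbF mulr0.
  - by rewrite !big1 ?addr0 // => k _; rewrite mxE mulr0.
by rewrite torsion_compE torsion_form_frame !E.
Qed.

End TorsionForm.

(** * The metric [g] and the nonlinear connection *)

HB.lock Definition G_mx {R : realType} {p n : nat} (S : local_data R p n)
  (ga : 'I_p) (u : jet R p n) : 'M[R]_n := \matrix_(i, j) Gcoef S i j ga u.

HB.lock Definition L_mx {R : realType} {p n : nat} (S : local_data R p n)
  (k : 'I_n) (u : jet R p n) : 'M[R]_n := \matrix_(i, j) Lcoef S i j k u.

HB.lock Definition C_mx {R : realType} {p n : nat} (S : local_data R p n)
  (ga : 'I_p) (k : 'I_n) (u : jet R p n) : 'M[R]_n := \matrix_(i, j) Ccoef S i ga j k u.

Section JetPoint.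
Context {R : realType} {p n : nat} {T : manifold R p} {M : manifold R n}.
Notation J := (jet R p n).

Lemma jet_prod_nbhs (A : set 'rV[R]_p) (B : set 'rV[R]_n) (u : J) :
  nbhs u.1.1 A -> nbhs u.1.2 B -> \forall w \near u, A w.1.1 /\ B w.1.2.
Proof.
move=> nA nB.
have c1 : {for u, continuous (fun w : J => w.1.1)}.
  apply: differentiable_continuous; do 2!apply: differentiable_fst.
  exact: differentiable_idf.
have c2 : {for u, continuous (fun w : J => w.1.2)}.
  apply: differentiable_continuous; apply: differentiable_snd; apply: differentiable_fst.
  exact: differentiable_idf.
by near=> w; split; near: w; [exact: c1|exact: c2].
Unshelve. all: by end_near. Qed.

Lemma jet_img_nbhs (c : chart T) (d : chart M) (u : J) :
  jet_img c d u -> nbhs u (jet_img c d).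
Proof. by move=> [cu du]; apply: jet_prod_nbhs; exact: img_nbhs. Qed.

Lemma differentiable_base (u : J) : differentiable (fun w : J => w.1.1) u.
Proof. do 2!apply: differentiable_fst; exact: differentiable_idf. Qed.

Lemma differentiable_space (u : J) : differentiable (fun w : J => w.1.2) u.
Proof. apply: differentiable_snd; apply: differentiable_fst; exact: differentiable_idf. Qed.

Lemma differentiable_velocity (u : J) : differentiable (fun w : J => w.2) u.
Proof. apply: differentiable_snd; exact: differentiable_idf. Qed.

Lemma der_base (W : normedModType R) (f : 'rV[R]_p -> W) (u z : J) :
  differentiable f u.1.1 -> der z (fun w : J => f w.1.1) u = der z.1.1 f u.1.1.
Proof.
move=> df; rewrite (@der_comp _ _ _ _ (fun w : J => w.1.1) f) //;
  last exact: differentiable_base.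
have du := differentiable_idf u.
by rewrite !der_fst ?der_idf //; exact: differentiable_fst.
Qed.

Lemma der_space (W : normedModType R) (f : 'rV[R]_n -> W) (u z : J) :
  differentiable f u.1.2 -> der z (fun w : J => f w.1.2) u = der z.1.2 f u.1.2.
Proof.
move=> df; rewrite (@der_comp _ _ _ _ (fun w : J => w.1.2) f) //;
  last exact: differentiable_space.
have du := differentiable_idf u.
by rewrite der_snd ?der_fst ?der_idf //; exact: differentiable_fst.
Qed.

Lemma der_velocity (u z : J) : der z (fun w : J => w.2) u = z.2.
Proof. by have du := differentiable_idf u; rewrite der_snd ?der_idf. Qed.

End JetPoint.

Section ConnectionCoefficients.
Context {R : realType} {p n : nat} {T : manifold R p} {M : manifold R n}.
Context (RG : rgogml T M) (c : chart T) (d : chart M) (u : jet R p n).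
Hypothesis cdu : jet_img c d u.
Notation J := (jet R p n).
Notation dlt k := (delta_mx 0 k).
Let S := local RG c d.
Let h := hmet RG c.
Let f := phimet RG d.
Implicit Types (w x y z : J).

Lemma gmxE w : gmx S w = f w.1.2 + (Acov RG c d w)^T *m Acov RG c d w.
Proof. by apply/matrixP => i j; rewrite !mxE big_ord1 !mxE. Qed.

Lemma Acov_differentiable w : jet_img c d w -> differentiable (Acov RG c d) w.
Proof.
move=> dw; apply: differentiable_mxP => i j; rewrite ord1.
exact: smooth_differentiable (A_smooth RG c d j) dw.
Qed.

Lemma phi_differentiable : differentiable (fun w : J => f w.1.2) u.
Proof.
apply: (@differentiable_comp _ _ _ _ (fun w : J => w.1.2) f).
  exact: differentiable_space.
by apply: metric_differentiable; have [] := cdu.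
Qed.

Lemma gmx_differentiable : differentiable (gmx S) u.
Proof.
have dA := Acov_differentiable cdu.
rewrite (_ : gmx S = fun w => f w.1.2 + (Acov RG c d w)^T *m Acov RG c d w); last first.
  by apply/funext => w; exact: gmxE.
apply: differentiableD; first exact: phi_differentiable.
by apply: differentiable_mulmx => //; exact: differentiable_trmx.
Qed.

Lemma gmx_sym w : jet_img c d w -> (gmx S w)^T = gmx S w.
Proof.
move=> [_ dw]; rewrite gmxE raddfD /= trmx_mul trmxK; congr (_ + _).
exact: Defs.metric_sym.
Qed.

Lemma gmx_unit : gmx S u \in unitmx.
Proof. by rewrite -row_full_unit /row_full; apply/eqP; exact: g_rank. Qed.

Lemma der_gmx_sym z : (der z (gmx S) u)^T = der z (gmx S) u.
Proof.
rewrite -der_trmx; last exact: gmx_differentiable.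
by apply: near_eq_der; apply: filterS (jet_img_nbhs cdu) => w dw; rewrite gmx_sym.
Qed.

Lemma along_g (X : J -> J) i j : along X (g S i j) u = der (X u) (gmx S) u i j.
Proof. by rewrite der_entry ?derE //; exact: gmx_differentiable. Qed.

Lemma G_mxE ga : G_mx S ga u =
  2^-1 *: (invmx (gmx S u) *m der (delta_t S ga u) (gmx S) u).
Proof.
apply/matrixP => i j; rewrite G_mx.unlock !mxE /Gcoef; congr (_ * _).
by apply: eq_bigr => m _; rewrite along_g.
Qed.

Lemma L_mxE k : L_mx S k u =
  christoffel2 (invmx (gmx S u)) (fun l => der (delta_x S l u) (gmx S) u) k.
Proof.
apply/matrixP => i j; rewrite L_mx.unlock christoffel2_entry mxE /Lcoef; congr (_ * _).
by apply: eq_bigr => m _; rewrite !along_g.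
Qed.

Lemma C_mxE ga k : C_mx S ga k u =
  christoffel2 (invmx (gmx S u)) (fun l => der (partial_v l ga u) (gmx S) u) k.
Proof.
apply/matrixP => i j; rewrite C_mx.unlock christoffel2_entry mxE /Ccoef; congr (_ * _).
by apply: eq_bigr => m _; rewrite !along_g.
Qed.

Lemma L_mx_sym i j k : L_mx S k u i j = L_mx S j u i k.
Proof. by rewrite !L_mxE christoffel2_sym // => l; exact: der_gmx_sym. Qed.

Lemma C_mx_sym ga i j k : C_mx S ga k u i j = C_mx S ga j u i k.
Proof. by rewrite !C_mxE christoffel2_sym // => l; exact: der_gmx_sym. Qed.

Lemma Mcon_christoffel i al be w : Mcon S i al be w = - (w.2 *m christoffel_mx h be w.1.1) i al.
Proof.
rewrite /Mcon; congr (- _); rewrite mxE; apply: eq_bigr => mu _.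
by rewrite /H christoffelE mulrC.
Qed.

Lemma Ncon_christoffel i al j w : jet_img c d w ->
  Ncon S i al j w = (christoffel_mx f j w.1.2 *m w.2) i al.
Proof.
move=> [_ dw]; rewrite /Ncon mxE; apply: eq_bigr => m _.
by rewrite /gam christoffelE (christoffel_mx_sym (phimet RG) _ _ _ dw).
Qed.

Lemma delta_tE al w : delta_t S al w = (dlt al, 0, w.2 *m christoffel_mx h al w.1.1).
Proof. by congr pair; apply/matrixP => j be; rewrite mxE Mcon_christoffel opprK. Qed.

Lemma delta_xE i w : jet_img c d w ->
  delta_x S i w = (0, dlt i, - (christoffel_mx f i w.1.2 *m w.2)).
Proof.
move=> dw; congr pair; apply/matrixP => j be.
by rewrite [LHS]mxE Ncon_christoffel // [RHS]mxE.
Qed.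

Lemma base_christoffel_differentiable al :
  differentiable (fun w : J => christoffel_mx h al w.1.1) u.
Proof.
apply: (@differentiable_comp _ _ _ _ (fun w : J => w.1.1) (christoffel_mx h al)).
  exact: differentiable_base.
by apply: christoffel_mx_differentiable; have [] := cdu.
Qed.

Lemma space_christoffel_differentiable i :
  differentiable (fun w : J => christoffel_mx f i w.1.2) u.
Proof.
apply: (@differentiable_comp _ _ _ _ (fun w : J => w.1.2) (christoffel_mx f i)).
  exact: differentiable_space.
by apply: christoffel_mx_differentiable; have [] := cdu.
Qed.

Lemma delta_t_velocity_differentiable al :
  differentiable (fun w : J => w.2 *m christoffel_mx h al w.1.1) u.
Proof.
apply: differentiable_mulmx; first exact: differentiable_velocity.
exact: base_christoffel_differentiable.
Qed.

Lemma delta_x_velocity_differentiable i :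
  differentiable (fun w : J => christoffel_mx f i w.1.2 *m w.2) u.
Proof.
apply: differentiable_mulmx; last exact: differentiable_velocity.
exact: space_christoffel_differentiable.
Qed.

Lemma Mcon_differentiable i al be : differentiable (Mcon S i al be) u.
Proof.
rewrite (_ : Mcon _ _ _ _ = fun w => - (w.2 *m christoffel_mx h be w.1.1) i al); last first.
  by apply/funext => w; exact: Mcon_christoffel.
by apply: differentiableN; apply: differentiable_entry; exact: delta_t_velocity_differentiable.
Qed.

Lemma Ncon_differentiable i al j : differentiable (Ncon S i al j) u.
Proof.
apply: (@near_eq_differentiable _ _ _ (fun w => (christoffel_mx f j w.1.2 *m w.2) i al)).
  by apply: filterS (jet_img_nbhs cdu) => w dw; rewrite Ncon_christoffel.
by apply: differentiable_entry; exact: delta_x_velocity_differentiable.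
Qed.

Lemma frame_differentiable a : differentiable (frame S a) u.
Proof.
case: a => [[al|i]|[i al]] /=.
- rewrite (_ : delta_t S al = fun w => (dlt al, 0, w.2 *m christoffel_mx h al w.1.1)); last first.
    by apply/funext => w; exact: delta_tE.
  by apply: differentiable_pair => //; exact: delta_t_velocity_differentiable.
- apply: (@near_eq_differentiable _ _ _ (fun w => (0, dlt i, - (christoffel_mx f i w.1.2 *m w.2)))).
    by apply: filterS (jet_img_nbhs cdu) => w dw; rewrite delta_xE.
  apply: differentiable_pair => //; apply: differentiableN.
  exact: delta_x_velocity_differentiable.
- exact: differentiable_cst.
Qed.

Lemma der_Mcon z i al be : der z (Mcon S i al be) u =
  - (z.2 *m christoffel_mx h be u.1.1 + u.2 *m der z.1.1 (christoffel_mx h be) u.1.1) i al.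
Proof.
rewrite (_ : Mcon _ _ _ _ = fun w => - (w.2 *m christoffel_mx h be w.1.1) i al); last first.
  by apply/funext => w; exact: Mcon_christoffel.
have dG := delta_t_velocity_differentiable be.
rewrite derN; last exact: differentiable_entry.
rewrite -der_entry // der_mulmx; last exact: base_christoffel_differentiable; last first.
  exact: differentiable_velocity.
rewrite der_velocity der_base //; apply: christoffel_mx_differentiable; by have [] := cdu.
Qed.

Lemma der_Ncon z i al j : der z (Ncon S i al j) u =
  (der z.1.2 (christoffel_mx f j) u.1.2 *m u.2 + christoffel_mx f j u.1.2 *m z.2) i al.
Proof.
rewrite (@near_eq_der _ _ _ _ (fun w => (christoffel_mx f j w.1.2 *m w.2) i al)); last first.
  by apply: filterS (jet_img_nbhs cdu) => w dw; rewrite Ncon_christoffel.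
have dG := delta_x_velocity_differentiable j.
rewrite -der_entry // der_mulmx; last exact: differentiable_velocity; last first.
  exact: space_christoffel_differentiable.
rewrite der_velocity der_space //; apply: christoffel_mx_differentiable; by have [] := cdu.
Qed.

End ConnectionCoefficients.

(** * Splitting of the Cartan coefficients *)

(** The Sherman-Morrison formula. The matrix [Q + a^T a] maps [Q^-1 a^T] to
    [(1 + s) a^T]; as it is invertible, [1 + s] does not vanish, for otherwise
    [Q^-1 a^T] and therefore [s] would be zero. *)
Lemma invmx_rank1_update (F : fieldType) n (Q : 'M[F]_n) (a : 'rV[F]_n) :
  Q \in unitmx -> Q + a^T *m a \in unitmx ->
  let s := (a *m invmx Q *m a^T) 0 0 in
  invmx (Q + a^T *m a) =
    invmx Q - (1 + s)^-1 *: (invmx Q *m a^T *m (a *m invmx Q)).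
Proof.
move=> uQ uG s.
have sE : a *m invmx Q *m a^T = s%:M by rewrite [LHS]mx11_scalar.
have GaE : (Q + a^T *m a) *m (invmx Q *m a^T) = (1 + s) *: a^T.
  rewrite mulmxDl mulKVmx // -!mulmxA [a *m _]mulmxA sE.
  by rewrite mul_mx_scalar scalerDl scale1r.
have s1 : 1 + s != 0.
  apply/eqP => s0; move: GaE; rewrite s0 scale0r => /(congr1 (mulmx (invmx (Q + a^T *m a)))).
  rewrite mulKmx // mulmx0 => a0.
  have s00 : s = 0 by rewrite /s -mulmxA a0 mulmx0 mxE.
  by move/eqP: s0; rewrite s00 addr0 oner_eq0.
rewrite -[LHS]mulmx1 -[RHS](mulKmx uG); congr (_ *m _).
rewrite mulmxBr -scalemxAr [_ *m (invmx Q *m a^T *m _)]mulmxA GaE -scalemxAl scalerA.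
by rewrite mulVf // scale1r mulmxDl mulmxV // !mulmxA addrK.
Qed.

Section InverseMetric.
Context {R : realType} {p n : nat} {T : manifold R p} {M : manifold R n}.
Context (RG : rgogml T M) (c : chart T) (d : chart M) (u : jet R p n).
Hypothesis cdu : jet_img c d u.
Notation J := (jet R p n).
Notation dlt k := (delta_mx 0 k).
Let S := local RG c d.
Let h := hmet RG c.
Let f := phimet RG d.
Implicit Types (w x y z : J).

Lemma phi_unit : f u.1.2 \in unitmx.
Proof. by apply: metric_nondegenerate; have [] := cdu. Qed.

Lemma phi_inv_sym i j : phi_inv S i j u = phi_inv S j i u.
Proof.
have [_ du] := cdu; transitivity ((invmx (f u.1.2))^T i j); last by rewrite mxE.
by rewrite trmx_inv (Defs.metric_sym (phimet RG) du).
Qed.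

Lemma g_invE i m : g_inv S i m u =
  phi_inv S i m u - A_up S i u * A_up S m u / (1 + A_0 S u).
Proof.
have uG := gmx_unit RG cdu.
rewrite /g_inv (gmxE RG c d) invmx_rank1_update -?(gmxE RG c d) //; last exact: phi_unit.
have upE k : (invmx (f u.1.2) *m (Acov RG c d u)^T) k 0 = A_up S k u.
  by rewrite mxE; apply: eq_bigr => l _; rewrite [_^T _ _]mxE.
have upE' k : (Acov RG c d u *m invmx (f u.1.2)) 0 k = A_up S k u.
  rewrite mxE; apply: eq_bigr => l _.
  by rewrite mulrC -[invmx _ l k]/(phi_inv S l k u) phi_inv_sym.
rewrite -mulmxA [(Acov RG c d u *m _) 0 0]mxE.
under [X in 1 + X]eq_bigr do rewrite upE.
have -> : \sum_j Acov RG c d u 0 j * A_up S j u = A_0 S u.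
  by apply: eq_bigr => j _; rewrite mulrC.
rewrite !mxE big_ord1 upE upE' -/(phi_inv S i m u); congr (_ - _).
by rewrite mulrC.
Qed.

Lemma g_inv_contract i (v : 'I_n -> R) :
  \sum_m g_inv S i m u * v m =
  \sum_m phi_inv S i m u * v m
  - (\sum_m v m * A_up S m u) * A_up S i u / (1 + A_0 S u).
Proof.
rewrite mulr_suml mulr_suml -sumrB; apply: eq_bigr => m _.
by rewrite g_invE; ring.
Qed.

Lemma der_gmx z j m : der z (gmx S) u j m =
  der z.1.2 f u.1.2 j m + der z (fun w => A S j w * A S m w) u.
Proof.
have dA := Acov_differentiable RG cdu.
have df := phi_differentiable RG cdu.
have dAA : differentiable (fun w => (Acov RG c d w)^T *m Acov RG c d w) u.
  by apply: differentiable_mulmx => //; exact: differentiable_trmx.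
rewrite (_ : gmx S = fun w => f w.1.2 + (Acov RG c d w)^T *m Acov RG c d w); last first.
  by apply/funext => w; exact: gmxE.
rewrite derD // mxE der_space; last first.
  by apply: metric_differentiable; have [] := cdu.
congr (_ + _); rewrite der_entry //; congr (der _ _ _).
by apply/funext => w; rewrite mxE big_ord1 mxE.
Qed.

Lemma gam_lowE j k m : gam_low S j k m u =
  2^-1 * (der (dlt k) f u.1.2 j m + der (dlt j) f u.1.2 k m - der (dlt m) f u.1.2 j k).
Proof.
have [_ du] := cdu.
have -> : gam_low S j k m u = (f u.1.2 *m christoffel_mx f k u.1.2) m j.
  by rewrite mxE; apply: eq_bigr => l _; rewrite /gam christoffelE.
by rewrite christoffel_mxE // /christoffel2 -scalemxAr mulKVmx ?phi_unit // !mxE.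
Qed.

Lemma phi_inv_gam_low i j k : \sum_m phi_inv S i m u * gam_low S j k m u = gam S i j k u.
Proof.
transitivity ((invmx (f u.1.2) *m (f u.1.2 *m christoffel_mx f k u.1.2)) i j).
  rewrite mxE; apply: eq_bigr => m _; congr (_ * _).
  by rewrite mxE; apply: eq_bigr => l _; rewrite /gam christoffelE.
by rewrite mulKmx ?phi_unit // /gam christoffelE.
Qed.

(** [g = phi + A A] is differentiated term by term, and the contraction with the
    inverse of [g] is split by the Sherman-Morrison formula; raising the index of the
    [phi] part gives back [gamma]. *)
Lemma Lcoef_Lambda i j k : Lcoef S i j k u = gam S i j k u + Lambda S i j k u.
Proof.
have -> : Lcoef S i j k u =
    \sum_m g_inv S i m u * (gam_low S j k m u + A_low S j k m u).
  rewrite /Lcoef mulr_sumr; apply: eq_bigr => m _.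
  rewrite !(along_g RG cdu) !der_gmx /A_low /along -!derE gam_lowE.
  rewrite -[(delta_x S k u).1.2]/(dlt k) -[(delta_x S j u).1.2]/(dlt j).
  rewrite -[(delta_x S m u).1.2]/(dlt m) mulrCA -mulrDr; congr (_ * (_ * _)).
  by ring.
rewrite g_inv_contract; under eq_bigr do rewrite mulrDr.
rewrite big_split /= phi_inv_gam_low /Lambda /gam_low0 /A_low0 -big_split /= -addrA.
congr (_ + (_ - _ * _ / _)).
by apply: eq_bigr => m _; rewrite mulrDl.
Qed.

(** As for [L], but [phi] does not depend on the velocities. *)
Lemma Ccoef_C1_C0 i ga j k : Ccoef S i ga j k u = C1 S ga i j k u + C0 S ga i j k u.
Proof.
have -> : Ccoef S i ga j k u = \sum_m g_inv S i m u * C_low S ga j k m u.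
  rewrite /Ccoef mulr_sumr; apply: eq_bigr => m _.
  rewrite !(along_g RG cdu) !der_gmx /C_low /along -!derE.
  have v0 l : (partial_v l ga u).1.2 = 0 :> 'rV[R]_n by [].
  have d0 : der 0 f u.1.2 = 0 by rewrite derE derive0.
  rewrite !v0 d0 !mxE !add0r mulrCA; congr (_ * (_ * _)).
by rewrite g_inv_contract.
Qed.

Lemma Lambda_sym i j k : Lambda S i j k u = Lambda S i k j u.
Proof.
have [_ du] := cdu.
have := L_mx_sym RG cdu i j k; rewrite L_mx.unlock !mxE !Lcoef_Lambda.
by rewrite /gam !christoffelE (christoffel_mx_sym (phimet RG) _ _ _ du) => /addrI.
Qed.

End InverseMetric.

(** * Adapted components of the torsion *)

Section Components.
Context {R : realType} {p n : nat} {T : manifold R p} {M : manifold R n}.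
Context (RG : rgogml T M) (c : chart T) (d : chart M) (u : jet R p n).
Hypothesis cdu : jet_img c d u.
Notation J := (jet R p n).
Notation dlt k := (delta_mx 0 k).
Let S := local RG c d.
Let h := hmet RG c.
Let f := phimet RG d.

Let cu : img c u.1.1. Proof. by have [] := cdu. Qed.
Let du : img d u.1.2. Proof. by have [] := cdu. Qed.
Let hor := torsion_comp_hor (Mcon_differentiable RG cdu) (Ncon_differentiable RG cdu)
  (frame_differentiable RG cdu).
Let vert := torsion_comp_vert (Mcon_differentiable RG cdu) (Ncon_differentiable RG cdu)
  (frame_differentiable RG cdu).

Let frame_t al : frame S (IT al) u = (dlt al, 0, u.2 *m christoffel_mx h al u.1.1).
Proof. exact: delta_tE. Qed.

Let frame_x i : frame S (IX i) u = (0, dlt i, - (christoffel_mx f i u.1.2 *m u.2)).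
Proof. exact: delta_xE. Qed.

Lemma H_christoffel al be ga : H S al be ga u = christoffel_mx h ga u.1.1 al be.
Proof. by rewrite /H christoffelE. Qed.

Lemma gam_christoffel i j k : gam S i j k u = christoffel_mx f k u.1.2 i j.
Proof. by rewrite /gam christoffelE. Qed.

Lemma Gcoef_mx i j ga : Gcoef S i j ga u = G_mx S ga u i j.
Proof. by rewrite G_mx.unlock mxE. Qed.

Lemma Lcoef_mx i j k : Lcoef S i j k u = L_mx S k u i j.
Proof. by rewrite L_mx.unlock mxE. Qed.

Lemma Ccoef_mx i ga j k : Ccoef S i ga j k u = C_mx S ga k u i j.
Proof. by rewrite C_mx.unlock mxE. Qed.

(** Antisymmetrizing the derivatives of [u.2 *m christoffel_mx h be] along the frame
    gives both the derivative and the commutator part of the curvature. *)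
Lemma torsion_comp_tt al be e : torsion_comp S (IT al) (IT be) e u =
  if e is IV m mu then (u.2 *m curvature_mx h al be u.1.1) m mu else 0.
Proof.
case: e => [[ga|i]|[m mu]].
- by rewrite hor /cartan !H_christoffel (christoffel_mx_sym (hmet RG) _ _ _ cu) subrr.
- by rewrite hor subrr.
rewrite vert /cartan subrr addr0 !(der_Mcon RG cdu).
rewrite !frame_t /=.
rewrite (curvature_mxE (hmet RG) _ _ cu) -/h !(mulmxDr, mulmxN, mulmxBr) !mulmxA.
move: (u.2 *m christoffel_mx h al _ *m christoffel_mx h be _).
move: (u.2 *m christoffel_mx h be _ *m christoffel_mx h al _).
move: (u.2 *m der _ (christoffel_mx h be) _) (u.2 *m der _ (christoffel_mx h al) _).
move=> X1 X2 X3 X4.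
by rewrite !mxE; ring.
Qed.

(** The base connection acts on the velocity from the right and the space connection
    from the left, so their mixed terms cancel. *)
Lemma torsion_comp_xt j al e : torsion_comp S (IX j) (IT al) e u =
  if e is IX m then - G_mx S al u m j else 0.
Proof.
case: e => [[ga|i]|[m mu]].
- by rewrite hor subrr.
- by rewrite hor /cartan Gcoef_mx sub0r.
rewrite vert /cartan subrr addr0 (der_Mcon RG cdu) (der_Ncon RG cdu).
rewrite frame_t frame_x /=.
have -> : der 0 (christoffel_mx h al) u.1.1 = 0 by rewrite derE derive0.
have -> : der 0 (christoffel_mx f j) u.1.2 = 0 by rewrite derE derive0.
by rewrite mulmx0 mul0mx addr0 add0r mulNmx mxE opprK mulmxA subrr.
Qed.

Lemma torsion_comp_xx i j e : torsion_comp S (IX i) (IX j) e u =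
  if e is IV m mu then (curvature_mx f j i u.1.2 *m u.2) m mu else 0.
Proof.
case: e => [[ga|k]|[m mu]].
- by rewrite hor subrr.
- by rewrite hor /cartan !Lcoef_mx (L_mx_sym RG cdu) subrr.
rewrite vert /cartan subrr addr0 !(der_Ncon RG cdu).
rewrite !frame_x /=.
rewrite (curvature_mxE (phimet RG) _ _ du) -/f !(mulmxDl, mulNmx, mulmxBl, mulmxN) !mulmxA.
move: (christoffel_mx f i _ *m christoffel_mx f j _ *m u.2).
move: (christoffel_mx f j _ *m christoffel_mx f i _ *m u.2).
move: (der _ (christoffel_mx f i) _ *m u.2) (der _ (christoffel_mx f j) _ *m u.2).
move=> X1 X2 X3 X4.
by rewrite !mxE; ring.
Qed.

Lemma torsion_comp_vt j be al e : torsion_comp S (IV j be) (IT al) e u =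
  if e is IV m mu then - ((be == mu)%:R * G_mx S al u m j) else 0.
Proof.
case: e => [[ga|i]|[m mu]].
- by rewrite hor subrr.
- by rewrite hor subrr.
rewrite vert /cartan subr0 sub0r (der_Mcon RG cdu) Gcoef_mx H_christoffel.
rewrite [frame S (IV j be) u]/(partial_v j be u) /=.
have -> : der 0 (christoffel_mx h al) u.1.1 = 0 by rewrite derE derive0.
rewrite mulmx0 addr0 mxE (bigD1 be) //= big1 => [|k ne]; last first.
  by rewrite mxE (negPf ne) andbF mul0r.
by rewrite mxE eqxx andbT addr0; ring.
Qed.

Lemma torsion_comp_vx j be i e : torsion_comp S (IV j be) (IX i) e u =
  match e with
  | IX m => C_mx S be j u m i
  | IV m mu => - ((be == mu)%:R * (L_mx S i u m j - christoffel_mx f i u.1.2 m j))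
  | _ => 0 end.
Proof.
case: e => [[ga|k]|[m mu]].
- by rewrite hor subrr.
- by rewrite hor /cartan Ccoef_mx subr0.
rewrite vert /cartan subr0 sub0r (der_Ncon RG cdu) Lcoef_mx.
rewrite [frame S (IV j be) u]/(partial_v j be u) /=.
have -> : der 0 (christoffel_mx f i) u.1.2 = 0 by rewrite derE derive0.
rewrite mul0mx add0r mxE (bigD1 j) //= big1 => [|k ne]; last first.
  by rewrite mxE (negPf ne) mulr0.
by rewrite mxE eqxx /= addr0 eq_sym; ring.
Qed.

Lemma torsion_comp_vv j be i al e : torsion_comp S (IV j be) (IV i al) e u =
  if e is IV m mu then (al == mu)%:R * C_mx S be j u m i - (be == mu)%:R * C_mx S al j u m i
  else 0.
Proof.
case: e => [[ga|k]|[m mu]].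
- by rewrite hor subrr.
- by rewrite hor subrr.
by rewrite vert /cartan !Ccoef_mx subrr add0r (C_mx_sym RG cdu al).
Qed.

End Components.

Lemma torsion_antisym (R : realType) p n (S : local_data R p n) X Y u :
  torsion S X Y u = - torsion S Y X u.
Proof.
have E (V : zmodType) (a b r s : V) : a - b - (r - s) = - (b - a - (s - r)).
  by rewrite !opprB addrC.
exact: E.
Qed.

Section TorsionVectors.
Context {R : realType} {p n : nat} {T : manifold R p} {M : manifold R n}.
Context (RG : rgogml T M) (c : chart T) (d : chart M) (u : jet R p n).
Hypothesis cdu : jet_img c d u.
Let S := local RG c d.

Lemma torsion_frame_comp a b : torsion S (frame S a) (frame S b) u =
  \sum_(m < n) torsion_comp S a b (IX m) u *: delta_x S m u
  + \sum_(al < p) torsion_comp S a b (IT al) u *: delta_t S al u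
  + \sum_(m < n) \sum_(mu < p) torsion_comp S a b (IV m mu) u *: partial_v m mu u.
Proof.
rewrite (torsion_frame (Mcon_differentiable RG cdu) (Ncon_differentiable RG cdu)
  (frame_differentiable RG cdu)).
under eq_bigr do rewrite -(torsion_compE (Mcon_differentiable RG cdu)
  (Ncon_differentiable RG cdu) (frame_differentiable RG cdu)).
by rewrite sum_idx [X in X + _]addrC.
Qed.

Lemma torsion_vert a b (F : 'I_n -> 'I_p -> R) :
  (forall e, torsion_comp S a b e u = if e is IV m mu then F m mu else 0) ->
  torsion S (frame S a) (frame S b) u =
  \sum_(m < n) \sum_(mu < p) F m mu *: partial_v m mu u.
Proof.
move=> E; rewrite torsion_frame_comp.
rewrite big1 => [|m _]; last by rewrite E scale0r.
rewrite big1 => [|m _]; last by rewrite E scale0r.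
by rewrite !add0r; apply: eq_bigr => m _; apply: eq_bigr => mu _; rewrite E.
Qed.

Lemma torsion_space a b (G : 'I_n -> R) (F : 'I_n -> 'I_p -> R) :
  (forall e, torsion_comp S a b e u =
     match e with IX m => G m | IV m mu => F m mu | _ => 0 end) ->
  torsion S (frame S a) (frame S b) u =
  \sum_(m < n) G m *: delta_x S m u
  + \sum_(m < n) \sum_(mu < p) F m mu *: partial_v m mu u.
Proof.
move=> E; rewrite torsion_frame_comp [X in _ + X + _]big1 => [|al _]; last first.
  by rewrite E scale0r.
rewrite addr0; congr (_ + _); first by apply: eq_bigr => m _; rewrite E.
by apply: eq_bigr => m _; apply: eq_bigr => mu _; rewrite E.
Qed.

Let du : img d u.1.2. Proof. by have [] := cdu. Qed.
Let cu : img c u.1.1. Proof. by have [] := cdu. Qed.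

Lemma curvature_mx_antisym (m : nat) (Q : manifold R m) (q : semi_riemannian Q) e x j k :
  img e x ->
  curvature_mx (q e) j k x = - curvature_mx (q e) k j x.
Proof. by move=> ex; rewrite !curvature_mxE // opprD !opprB. Qed.

Lemma torsion_tt al be :
  torsion S (delta_t S be) (delta_t S al) u =
    \sum_(m < n) \sum_(mu < p)
     (- \sum_(ga < p) curvature (hl S) ga mu al be u.1.1 * u.2 m ga) *: partial_v m mu u.
Proof.
apply: (@torsion_vert (IT be) (IT al)) => e; rewrite (torsion_comp_tt RG cdu).
case: e => [[ga|i]|[m mu]] //; rewrite (curvature_mx_antisym (hmet RG) _ _ cu) mulmxN mxE.
by congr (- _); rewrite mxE; apply: eq_bigr => ga _; rewrite curvatureE mulrC.
Qed.

Lemma torsion_xt al j :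
  torsion S (delta_x S j) (delta_t S al) u =
    \sum_(m < n) (- Gcoef S m j al u) *: delta_x S m u
    + \sum_(m < n) \sum_(mu < p) (0 : R) *: partial_v m mu u.
Proof.
apply: (@torsion_space (IX j) (IT al)) => e; rewrite (torsion_comp_xt RG cdu).
by case: e => [[ga|i]|[m mu]] //; rewrite Gcoef_mx.
Qed.

Lemma torsion_xx i j :
  torsion S (delta_x S j) (delta_x S i) u =
    \sum_(m < n) \sum_(mu < p)
      (\sum_(k < n) curvature (phil S) m k i j u.1.2 * u.2 k mu) *: partial_v m mu u.
Proof.
apply: (@torsion_vert (IX j) (IX i)) => e; rewrite (torsion_comp_xx RG cdu).
case: e => [[ga|k]|[m mu]] //.
by rewrite mxE; apply: eq_bigr => k _; rewrite curvatureE.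
Qed.

Lemma torsion_vt al be j :
  torsion S (partial_v j be) (delta_t S al) u =
    \sum_(m < n) \sum_(mu < p)
      (- ((be == mu)%:R * Gcoef S m j al u)) *: partial_v m mu u.
Proof.
apply: (@torsion_vert (IV j be) (IT al)) => e; rewrite (torsion_comp_vt RG cdu).
by case: e => [[ga|k]|[m mu]] //; rewrite Gcoef_mx.
Qed.

Lemma torsion_vx be i j :
  torsion S (partial_v j be) (delta_x S i) u =
    \sum_(m < n) (C1 S be m i j u + C0 S be m i j u) *: delta_x S m u
    + \sum_(m < n) \sum_(mu < p)
        (- ((be == mu)%:R * Lambda S m i j u)) *: partial_v m mu u.
Proof.
apply: (@torsion_space (IV j be) (IX i)) => e; rewrite (torsion_comp_vx RG cdu).
case: e => [[ga|k]|[m mu]] //.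
  by rewrite -(Ccoef_C1_C0 RG cdu) Ccoef_mx.
by rewrite -Lcoef_mx (Lcoef_Lambda RG cdu) gam_christoffel addrC addKr (Lambda_sym RG cdu).
Qed.

Lemma torsion_vv al be i j :
  torsion S (partial_v j be) (partial_v i al) u =
    \sum_(m < n) \sum_(mu < p)
      ((al == mu)%:R * Ccoef S m be i j u
       - (be == mu)%:R * Ccoef S m al i j u) *: partial_v m mu u.
Proof.
apply: (@torsion_vert (IV j be) (IV i al)) => e; rewrite (torsion_comp_vv RG cdu).
by case: e => [[ga|k]|[m mu]] //; rewrite !Ccoef_mx.
Qed.

End TorsionVectors.

Lemma christoffel2_sum (R : realType) n (Qi : 'M[R]_n) (K : finType) (r : K -> R)
    (DQ : K -> 'I_n -> 'M[R]_n) k :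
  christoffel2 Qi (fun l => \sum_b r b *: DQ b l) k = \sum_b r b *: christoffel2 Qi (DQ b) k.
Proof.
rewrite /christoffel2 (_ : christoffel1 _ k = \sum_b r b *: christoffel1 (DQ b) k).
  rewrite mulmx_sumr scaler_sumr; apply: eq_bigr => b _.
  by rewrite -scalemxAr !scalerA mulrC.
apply/matrixP => l j; rewrite mxE !summxE -big_split -sumrB /=; apply: eq_bigr => b _.
by rewrite !mxE; ring.
Qed.

Lemma der0 (R : realType) (V W : normedModType R) (f : V -> W) x : der 0 f x = 0.
Proof. by rewrite derE derive0. Qed.

(** * Change of jet coordinates *)

Section JetChange.
Context {R : realType} {p n : nat} {T : manifold R p} {M : manifold R n}.
Context (RG : rgogml T M) (c c' : chart T) (d d' : chart M) (u : jet R p n).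
Hypothesis ou : jet_overlap c c' d d' u.
Notation J := (jet R p n).
Notation dlt k := (delta_mx 0 k).
Let S := local RG c d.
Let S' := local RG c' d'.
Let u' := jet_trans c c' d d' u.
Let Jt := jac c c' u.1.1.
Let Jx := jac d d' u.1.2.
Let K := jac c' c (trans c c' u.1.1).

Let out : overlap c c' u.1.1. Proof. by have [] := ou. Qed.
Let oux : overlap d d' u.1.2. Proof. by have [] := ou. Qed.

Lemma jet_overlap_img : jet_img c d u.
Proof. by split; apply: overlap_img; [exact: out|exact: oux]. Qed.

Lemma jet_trans_img : jet_img c' d' u'.
Proof. by split; apply: overlap_img; apply: overlap_trans; [exact: out|exact: oux]. Qed.

Lemma jet_overlap_nbhs : nbhs u (jet_overlap c c' d d').
Proof. by apply: jet_prod_nbhs; exact: overlap_nbhs. Qed.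

Lemma jacV_differentiable : differentiable (fun y => jac c' c (trans c c' y)) u.1.1.
Proof.
apply: (@differentiable_comp _ _ _ _ (trans c c') (jac c' c)).
  exact: trans_differentiable.
by apply: jac_differentiable; exact: overlap_trans.
Qed.

Lemma der_jacV z : der z (fun y => jac c' c (trans c c' y)) u.1.1 =
  - (K *m der z (jac c c') u.1.1 *m K).
Proof.
have dJ := jac_differentiable out; have dV := jacV_differentiable.
have : der z (fun y => jac c' c (trans c c' y) *m jac c c' y) u.1.1 = 0.
  rewrite (@near_eq_der _ _ _ _ (fun=> 1%:M)) ?der_cst //.
  by apply: filterS (overlap_nbhs out) => y oy; exact: jac_mulV.
rewrite der_mulmx // => /(canRL (addrK _)); rewrite sub0r => E.
by rewrite -mulNmx -E -mulmxA jac_mul // mulmx1.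
Qed.

(* Regularity of the blocks of [jet_trans], for the side conditions below. *)
Let jacx_diff : differentiable (fun w : J => jac d d' w.1.2) u.
Proof.
apply: (@differentiable_comp _ _ _ _ (fun w : J => w.1.2) (jac d d')).
  exact: differentiable_space.
exact: jac_differentiable.
Qed.

Let jacV_diff : differentiable (fun w : J => jac c' c (trans c c' w.1.1)) u.
Proof.
apply: (@differentiable_comp _ _ _ _ (fun w : J => w.1.1) (fun y => jac c' c (trans c c' y))).
  exact: differentiable_base.
exact: jacV_differentiable.
Qed.

Let transt_diff : differentiable (fun w : J => trans c c' w.1.1) u.
Proof.
apply: (@differentiable_comp _ _ _ _ (fun w : J => w.1.1) (trans c c')).
  exact: differentiable_base.
exact: trans_differentiable.
Qed.

Let transx_diff : differentiable (fun w : J => trans d d' w.1.2) u.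
Proof.
apply: (@differentiable_comp _ _ _ _ (fun w : J => w.1.2) (trans d d')).
  exact: differentiable_space.
exact: trans_differentiable.
Qed.

Let vel_diff : differentiable (fun w : J =>
  jac d d' w.1.2 *m w.2 *m jac c' c (trans c c' w.1.1)) u.
Proof.
apply: differentiable_mulmx => //; apply: differentiable_mulmx => //.
exact: differentiable_velocity.
Qed.

Lemma jet_trans_differentiable : differentiable (jet_trans c c' d d') u.
Proof. by apply: differentiable_pair => //; exact: differentiable_pair. Qed.

Lemma der_jet_trans z : der z (jet_trans c c' d d') u =
  (z.1.1 *m Jt^T, z.1.2 *m Jx^T,
   der z.1.2 (jac d d') u.1.2 *m u.2 *m K + Jx *m z.2 *m K
   - Jx *m u.2 *m (K *m der z.1.1 (jac c c') u.1.1 *m K)).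
Proof.
have dv := differentiable_velocity u.
rewrite [LHS]der_pair //; last exact: differentiable_pair.
rewrite der_pair // der_base; last exact: trans_differentiable.
rewrite der_space; last exact: trans_differentiable.
rewrite !der_trans //; congr (_, _, _).
rewrite der_mulmx //; last exact: differentiable_mulmx.
rewrite der_mulmx // der_velocity der_space; last exact: jac_differentiable.
rewrite (@der_base _ _ _ _ (fun y => jac c' c (trans c c' y))); last exact: jacV_differentiable.
by rewrite der_jacV mulmxN mulmxDl.
Qed.

(** The Christoffel law of [h] turns the derivative of the inverse Jacobian into the
    difference of the two nonlinear connections. *)
Lemma der_jet_trans_t al : der (delta_t S al u) (jet_trans c c' d d') u =
  \sum_al' Jt al' al *: delta_t S' al' u'.
Proof.
rewrite der_jet_trans delta_tE /= der0 !mul0mx add0r.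
apply: injective_projections; first apply: injective_projections.
- rewrite !fst_sum /= -rowE [LHS]row_sum_delta; apply: eq_bigr => i _.
  by rewrite !mxE.
- by rewrite !fst_sum snd_sum /= big1 // => i _; rewrite scaler0.
rewrite snd_sum /=.
under eq_bigr => al' _.
  rewrite (_ : \matrix_(j, be) _ = u'.2 *m christoffel_mx (hmet RG c') al' u'.1.1); last first.
    by apply/matrixP => j be; rewrite mxE Mcon_christoffel opprK.
  rewrite scalemxAr; over.
rewrite -mulmx_sumr.
have law := christoffel_mx_change (hmet RG) al out.
set P := \sum_i _ in law; rewrite -[\sum_i _]/P.
have key : christoffel_mx (hmet RG c) al u.1.1 *m K =
    K *m P + K *m der (dlt al) (jac c c') u.1.1 *m K.
  rewrite -[christoffel_mx _ _ _]mul1mx -(jac_mulV out).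
  rewrite -[_ *m _ *m christoffel_mx _ _ _]mulmxA law.
  by rewrite mulmxDr mulmxDl -!mulmxA jac_mul // mulmx1.
by rewrite -!mulmxA key -mulmxA mulmxDr mulmxDr addrK !mulmxA.
Qed.

(** The same cancellation as for the base, now with the Christoffel law of [phi]. *)
Lemma der_jet_trans_x i : der (delta_x S i u) (jet_trans c c' d d') u =
  \sum_i' Jx i' i *: delta_x S' i' u'.
Proof.
rewrite der_jet_trans (delta_xE _ _ jet_overlap_img) /=.
rewrite der0 !(mul0mx, mulmx0) subr0.
apply: injective_projections; first apply: injective_projections.
- by rewrite !fst_sum /= big1 // => k _; rewrite scaler0.
- rewrite !fst_sum snd_sum /= -rowE [LHS]row_sum_delta; apply: eq_bigr => k _.
  by rewrite !mxE.
rewrite snd_sum /=.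
under eq_bigr => k _.
  rewrite (_ : \matrix_(j, be) _ =
      - (christoffel_mx (phimet RG d') k u'.1.2 *m u'.2)); last first.
    apply/matrixP => j be.
    by rewrite [LHS]mxE (Ncon_christoffel RG _ _ _ jet_trans_img) [RHS]mxE.
  rewrite scalerN scalemxAl; over.
rewrite sumrN -mulmx_suml.
have law := christoffel_mx_change (phimet RG) i oux.
set P := \sum_k _ in law; rewrite -[\sum_k _]/P.
rewrite !mulmxA -[P *m _]/(P *m jac d d' u.1.2) (canRL (addrK _) (esym law)).
by rewrite !(mulmxBl, mulmxN, mulNmx) opprB !mulmxA.
Qed.

Lemma der_jet_trans_v i al : der (partial_v i al u) (jet_trans c c' d d') u =
  \sum_i' Jx i' i *: \sum_al' K al al' *: partial_v i' al' u'.
Proof.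
rewrite der_jet_trans /= !der0 !(mul0mx, mulmx0) subr0 add0r.
apply: injective_projections; first apply: injective_projections.
- rewrite !fst_sum /= big1 // => k _; rewrite /= !fst_sum /= big1 ?scaler0 // => be _.
  by rewrite scaler0.
- rewrite !fst_sum snd_sum /= big1 // => k _.
  rewrite /= fst_sum snd_sum /= big1 ?scaler0 // => be _.
  by rewrite scaler0.
rewrite snd_sum /=; under eq_bigr do rewrite snd_sum scaler_sumr.
under eq_bigr do under eq_bigr do rewrite scalerA.
rewrite (sum_delta (fun k be => Jx k i * K al be)); apply/matrixP => k be.
rewrite [RHS]mxE [LHS]mxE (bigD1 al) //= big1 => [|mu ne]; last first.
  by rewrite mxE big1 ?mul0r // => j _; rewrite [delta_mx _ _ _ _]mxE (negPf ne) andbF mulr0.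
rewrite addr0 mxE (bigD1 i) //= big1 => [|j ne]; last first.
  by rewrite [delta_mx _ _ _ _]mxE (negPf ne) mulr0.
by rewrite addr0 [delta_mx _ _ _ _]mxE !eqxx mulr1.
Qed.

End JetChange.

Section CoefficientChange.
Context {R : realType} {p n : nat} {T : manifold R p} {M : manifold R n}.
Context (RG : rgogml T M) (c c' : chart T) (d d' : chart M) (u : jet R p n).
Hypothesis ou : jet_overlap c c' d d' u.
Notation J := (jet R p n).
Notation dlt k := (delta_mx 0 k).
Let S := local RG c d.
Let S' := local RG c' d'.
Let u' := jet_trans c c' d d' u.
Let Jt := jac c c' u.1.1.
Let Jx := jac d d' u.1.2.
Let K := jac c' c (trans c c' u.1.1).

Let out : overlap c c' u.1.1. Proof. by have [] := ou. Qed.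
Let oux : overlap d d' u.1.2. Proof. by have [] := ou. Qed.
Let cdu : jet_img c d u. Proof. exact: jet_overlap_img ou. Qed.
Let cdu' : jet_img c' d' u'. Proof. exact: jet_trans_img ou. Qed.

Lemma gmx_change w : jet_overlap c c' d d' w ->
  gmx S w = (jac d d' w.1.2)^T *m gmx S' (jet_trans c c' d d' w) *m jac d d' w.1.2.
Proof.
move=> ow; have [_ owx] := ow.
rewrite !gmxE mulmxDr mulmxDl -(metric_change (phimet RG) owx); congr (_ + _).
by rewrite (A_change RG ow) trmx_mul !mulmxA.
Qed.

Lemma der_gmx_change z : der z (gmx S) u =
  (der z.1.2 (jac d d') u.1.2)^T *m gmx S' u' *m Jx
  + Jx^T *m der (der z (jet_trans c c' d d') u) (gmx S') u' *m Jx
  + Jx^T *m gmx S' u' *m der z.1.2 (jac d d') u.1.2.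
Proof.
have dJ := jac_differentiable oux.
have dg' := gmx_differentiable RG cdu'.
have dJw : differentiable (fun w : J => jac d d' w.1.2) u.
  apply: (@differentiable_comp _ _ _ _ (fun w : J => w.1.2) (jac d d')) => //.
  exact: differentiable_space.
have dJT := differentiable_trmx dJw.
have djt := jet_trans_differentiable ou.
have dgt : differentiable (fun w => gmx S' (jet_trans c c' d d' w)) u.
  exact: differentiable_comp.
rewrite (@near_eq_der _ _ _ _ (fun w => (jac d d' w.1.2)^T *m
  gmx S' (jet_trans c c' d d' w) *m jac d d' w.1.2)); last first.
  by apply: filterS (jet_overlap_nbhs ou) => w; exact: gmx_change.
rewrite der_mulmx //; last exact: differentiable_mulmx.
rewrite der_mulmx // der_trmx // der_space // mulmxDl.
by rewrite (@der_comp _ _ _ _ (jet_trans c c' d d') (gmx S')).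
Qed.

Let uJ : Jx \in unitmx. Proof. exact: jac_unit. Qed.

(** Along the base direction the Jacobian of the space coordinates is constant, so the
    law is homogeneous. *)
Lemma G_mx_change ga : Jx *m G_mx S ga u = (\sum_ga' Jt ga' ga *: G_mx S' ga' u') *m Jx.
Proof.
have dg' := gmx_differentiable RG cdu'.
have ug' := gmx_unit RG cdu'.
have derE : der (delta_t S ga u) (gmx S) u =
    Jx^T *m (\sum_ga' Jt ga' ga *: der (delta_t S' ga' u') (gmx S') u') *m Jx.
  rewrite der_gmx_change der_jet_trans_t // der_sumv //.
  rewrite [(delta_t S ga u).1.2]/(0 : 'rV[R]_n) der0 trmx0 !mul0mx mulmx0 add0r addr0.
  by congr (_ *m _ *m _); apply: eq_bigr => ga' _; rewrite derZv.
rewrite (G_mxE RG cdu) derE -scalemxAr gmx_change // !mulmxA invmx_congruence //.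
rewrite scalemxAl; congr (_ *m _); rewrite mulmx_sumr scaler_sumr.
apply: eq_bigr => ga' _; rewrite (G_mxE RG cdu') -scalemxAr !scalerA; congr (_ *: _).
exact: mulrC.
Qed.

(** The frame vectors [delta_x] transform like coordinate vectors of the space, so the
    derivatives of [g] along them have the form required by [christoffel2_change]. *)
Lemma L_mx_change k : Jx *m L_mx S k u =
  (\sum_l Jx l k *: L_mx S' l u') *m Jx + der (dlt k) (jac d d') u.1.2.
Proof.
have dg' := gmx_differentiable RG cdu'.
rewrite L_mxE //; under [in RHS]eq_bigr do rewrite L_mxE //.
apply: (@christoffel2_change _ _ _ _ _ (fun l => der (delta_x S l u) (gmx S) u)
  (fun l => der (delta_x S' l u') (gmx S') u') (fun l => der (dlt l) (jac d d') u.1.2)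
  uJ (gmx_unit RG cdu') (gmx_sym RG cdu') (gmx_change ou)).
- by move=> i j l; exact: der_jac_sym.
move=> l; rewrite der_gmx_change der_jet_trans_x // der_sumv //.
congr (_ + _ *m _ *m _ + _); apply: eq_bigr => j _.
by rewrite derZv.
Qed.

(** Again [christoffel2_change], with no inhomogeneous term since the Jacobian does
    not depend on the velocities. *)
Lemma C_mx_change be k : Jx *m C_mx S be k u =
  (\sum_l Jx l k *: \sum_be' K be be' *: C_mx S' be' l u') *m Jx.
Proof.
have dg' := gmx_differentiable RG cdu'.
rewrite C_mxE //.
under [in RHS]eq_bigr do under eq_bigr do rewrite C_mxE //.
under [in RHS]eq_bigr do rewrite -christoffel2_sum.
rewrite -[RHS]addr0.
apply: (@christoffel2_change _ _ _ _ _ (fun l => der (partial_v l be u) (gmx S) u)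
  (fun l => \sum_be' K be be' *: der (partial_v l be' u') (gmx S') u') (fun=> 0)
  uJ (gmx_unit RG cdu') (gmx_sym RG cdu') (gmx_change ou)).
- by move=> i j l; rewrite !mxE.
move=> l; rewrite der_gmx_change der_jet_trans_v // der_sumv //.
rewrite [(partial_v l be u).1.2]/(0 : 'rV[R]_n) der0.
congr (_ + _ *m _ *m _ + _); apply: eq_bigr => j _.
rewrite derZv // der_sumv //; congr (_ *: _); apply: eq_bigr => be' _.
by rewrite derZv.
Qed.

Lemma L_sub_christoffel_change k : Jx *m (L_mx S k u - christoffel_mx (phimet RG d) k u.1.2) =
  (\sum_l Jx l k *: (L_mx S' l u' - christoffel_mx (phimet RG d') l u'.1.2)) *m Jx.
Proof.
rewrite mulmxBr L_mx_change (christoffel_mx_change (phimet RG) k oux) opprD addrACA subrr addr0.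
rewrite -mulmxBl -sumrB; congr (_ *m _); apply: eq_bigr => l _.
by rewrite scalerBr.
Qed.

End CoefficientChange.

(** * Tensoriality of the components *)

Lemma torsion_comp_antisym (R : realType) p n (S : local_data R p n) a b e w :
  torsion_comp S a b e w = - torsion_comp S b a e w.
Proof. by rewrite /torsion_comp torsion_antisym -scaleN1r coframeZ mulN1r. Qed.

Section Contractions.
Context {R : comNzRingType} {m1 m2 m3 m4 : nat}.

Lemma mulmx3_entry (X : 'M[R]_(m1, m2)) (Y : 'M[R]_(m2, m3)) (Z : 'M[R]_(m3, m4)) i j :
  (X *m Y *m Z) i j = \sum_k \sum_l X i k * Z l j * Y k l.
Proof.
rewrite mxE exchange_big /=; apply: eq_bigr => l _; rewrite mxE mulr_suml.
by apply: eq_bigr => k _; rewrite mulrAC.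
Qed.

Lemma mulmx_contract (I1 : finType) (r : I1 -> R) (X : 'M[R]_(m1, m2))
    (Y : I1 -> 'M[R]_(m2, m3)) (Z : 'M[R]_(m3, m4)) i j :
  (X *m (\sum_a r a *: Y a) *m Z) i j = \sum_a r a * (X *m Y a *m Z) i j.
Proof.
rewrite mulmx_sumr mulmx_suml summxE; apply: eq_bigr => a _.
by rewrite -scalemxAr -scalemxAl mxE.
Qed.

End Contractions.

Lemma mx_sub_entry (R : nzRingType) m1 m2 (A B : 'M[R]_(m1, m2)) i j :
  (A - B) i j = A i j - B i j.
Proof. by rewrite !mxE. Qed.

Lemma eq0_mulr (R : pzRingType) (x y : R) : y = 0 -> x * y = 0.
Proof. by move=> ->; rewrite mulr0. Qed.

Section Tensor.
Context {R : realType} {p n : nat} {T : manifold R p} {M : manifold R n}.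
Context (RG : rgogml T M) (c c' : chart T) (d d' : chart M) (u : jet R p n).
Hypothesis ou : jet_overlap c c' d d' u.
Notation J := (jet R p n).
Notation I := (idx p n).
Let S := local RG c d.
Let S' := local RG c' d'.
Let u' := jet_trans c c' d d' u.
Let Jt := jac c c' u.1.1.
Let Jx := jac d d' u.1.2.
Let K := jac c' c (trans c c' u.1.1).
Let D a' a := djac c c' d d' a' a u.
Let F a b e := torsion_comp S a b e u.
Let F' a b e := torsion_comp S' a b e u'.

Let out : overlap c c' u.1.1. Proof. by have [] := ou. Qed.
Let oux : overlap d d' u.1.2. Proof. by have [] := ou. Qed.
Let cdu : jet_img c d u. Proof. exact: jet_overlap_img ou. Qed.
Let cdu' : jet_img c' d' u'. Proof. exact: jet_trans_img ou. Qed.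

Lemma djac_suml_t al (X : I -> R) :
  \sum_a' D a' (IT al) * X a' = \sum_al' Jt al' al * X (IT al').
Proof.
rewrite sum_idx /= [X in _ + X]big1 => [|i _]; last by rewrite big1 // => be _; exact: mul0r.
by rewrite [X in _ + X + _]big1 => [|i _]; rewrite ?mul0r ?addr0.
Qed.

Lemma djac_suml_x i (X : I -> R) :
  \sum_a' D a' (IX i) * X a' = \sum_i' Jx i' i * X (IX i').
Proof.
rewrite sum_idx /= [X in _ + X]big1 => [|k _]; last by rewrite big1 // => be _; exact: mul0r.
by rewrite [X in X + _ + _]big1 => [|k _]; rewrite ?mul0r ?addr0 ?add0r.
Qed.

Lemma djac_suml_v i al (X : I -> R) :
  \sum_a' D a' (IV i al) * X a' =
  \sum_i' \sum_al' Jx i' i * K al al' * X (IV i' al').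
Proof.
rewrite sum_idx /= [X in X + _ + _]big1 => [|k _]; last exact: mul0r.
by rewrite [X in _ + X + _]big1 => [|k _]; rewrite ?mul0r ?addr0 ?add0r.
Qed.

Lemma djac_sumr_t al' (X : I -> R) :
  \sum_a D (IT al') a * X a = \sum_al Jt al' al * X (IT al).
Proof.
rewrite sum_idx /= [X in _ + X]big1 => [|i _]; last by rewrite big1 // => be _; exact: mul0r.
by rewrite [X in _ + X + _]big1 => [|i _]; rewrite ?mul0r ?addr0.
Qed.

Lemma djac_sumr_x i' (X : I -> R) :
  \sum_a D (IX i') a * X a = \sum_i Jx i' i * X (IX i).
Proof.
rewrite sum_idx /= [X in _ + X]big1 => [|k _]; last by rewrite big1 // => be _; exact: mul0r.
by rewrite [X in X + _ + _]big1 => [|k _]; rewrite ?mul0r ?addr0 ?add0r.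
Qed.

Lemma djac_sumr_v i' al' (X : I -> R) :
  \sum_a D (IV i' al') a * X a =
  \sum_i \sum_al Jx i' i * K al al' * X (IV i al).
Proof.
rewrite sum_idx /= [X in X + _ + _]big1 => [|k _]; last exact: mul0r.
by rewrite [X in _ + X + _]big1 => [|k _]; rewrite ?mul0r ?addr0 ?add0r.
Qed.

Definition djac_sumr := (djac_sumr_t, djac_sumr_x, djac_sumr_v).
Definition djac_suml := (djac_suml_t, djac_suml_x, djac_suml_v).

(** The tensorial law with [a] and [b] fixed and the contractions nested, so that
    each is simplified in turn by the block structure of the Jacobian. *)
Definition tensor_law a b := forall e',
  \sum_e D e' e * F a b e = \sum_a' D a' a * \sum_b' D b' b * F' a' b' e'.

Lemma tensor_law_sym a b : tensor_law a b -> tensor_law b a.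
Proof.
move=> L e'; rewrite -[LHS]opprK -sumrN.
under eq_bigr do rewrite -mulrN /F -torsion_comp_antisym.
rewrite L -sumrN; under eq_bigr do rewrite mulr_sumr -sumrN.
rewrite exchange_big; apply: eq_bigr => b' _; rewrite mulr_sumr.
apply: eq_bigr => a' _; rewrite /F' [in RHS]torsion_comp_antisym; ring.
Qed.

(* For the components that vanish for reasons of type. *)
Ltac zero_sum comp := first
  [ by rewrite ?comp ?mulr0
  | apply: big1 => ? _; zero_sum comp
  | apply: eq0_mulr; zero_sum comp ].

Ltac both_zero comp comp' :=
  transitivity (0 : R); [zero_sum comp | symmetry; zero_sum comp'].

(** The factor [Jx *m u.2] is common to both sides; the law of the curvature of [h]
    absorbs the inverse Jacobian on the right. *)
Lemma tensor_law_tt al be : tensor_law (IT al) (IT be).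
Proof.
move=> e'; rewrite !djac_suml; under [RHS]eq_bigr do rewrite djac_suml.
case: e' => [[al'|i']|[i' mu']]; rewrite djac_sumr /F /F'.
- by both_zero (torsion_comp_tt RG cdu) (torsion_comp_tt RG cdu').
- by both_zero (torsion_comp_tt RG cdu) (torsion_comp_tt RG cdu').
have law := curvature_mx_change (hmet RG) al be out.
transitivity ((Jx *m (u.2 *m curvature_mx (hmet RG c) al be u.1.1) *m K) i' mu').
  rewrite mulmx3_entry; apply: eq_bigr => i _; apply: eq_bigr => a _.
  by rewrite (torsion_comp_tt RG cdu).
transitivity ((u'.2 *m (\sum_a Jt a al *: (\sum_b Jt b be *:
    curvature_mx (hmet RG c') a b u'.1.1)) *m 1%:M) i' mu'); last first.
  rewrite mulmx_contract; apply: eq_bigr => a _; rewrite mulmx_contract.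
  by congr (_ * _); apply: eq_bigr => b _; rewrite (torsion_comp_tt RG cdu') mulmx1.
rewrite (_ : \sum_a _ =
    \sum_a \sum_b (Jt a al * Jt b be) *: curvature_mx (hmet RG c') a b u'.1.1).
  rewrite -[u'.2]/(Jx *m u.2 *m K) -!mulmxA -(jac_mul out) -/K -/Jt.
  by rewrite (mulmxA _ Jt K) -law -!mulmxA (mulmxA K Jt) jac_mulV // mul1mx.
apply: eq_bigr => a _; rewrite scaler_sumr; apply: eq_bigr => b _.
by rewrite scalerA.
Qed.

Lemma tensor_law_xt j al : tensor_law (IX j) (IT al).
Proof.
move=> e'; rewrite !djac_suml; under [RHS]eq_bigr do rewrite djac_suml.
case: e' => [[al'|m']|[i' mu']]; rewrite djac_sumr /F /F'.
- by both_zero (torsion_comp_xt RG cdu) (torsion_comp_xt RG cdu').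
- have law := G_mx_change RG ou al.
  transitivity (- (Jx *m G_mx S al u) m' j).
    rewrite mxE -sumrN; apply: eq_bigr => m _.
    by rewrite (torsion_comp_xt RG cdu) mulrN.
  rewrite law mxE -sumrN; apply: eq_bigr => j' _.
  rewrite summxE mulr_suml mulr_sumr -sumrN; apply: eq_bigr => b _.
  by rewrite (torsion_comp_xt RG cdu') mxE; ring.
- by both_zero (torsion_comp_xt RG cdu) (torsion_comp_xt RG cdu').
Qed.

(** Here the curvature acts from the left and [u.2 *m K] is the common factor. *)
Lemma tensor_law_xx i j : tensor_law (IX i) (IX j).
Proof.
move=> e'; rewrite !djac_suml; under [RHS]eq_bigr do rewrite djac_suml.
case: e' => [[al'|i']|[i' mu']]; rewrite djac_sumr /F /F'.
- by both_zero (torsion_comp_xx RG cdu) (torsion_comp_xx RG cdu').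
- by both_zero (torsion_comp_xx RG cdu) (torsion_comp_xx RG cdu').
have law := curvature_mx_change (phimet RG) j i oux.
transitivity ((Jx *m (curvature_mx (phimet RG d) j i u.1.2 *m u.2) *m K) i' mu').
  rewrite mulmx3_entry; apply: eq_bigr => k _; apply: eq_bigr => a _.
  by rewrite (torsion_comp_xx RG cdu).
transitivity ((1%:M *m (\sum_a Jx a i *: (\sum_b Jx b j *:
    curvature_mx (phimet RG d') b a u'.1.2)) *m u'.2) i' mu'); last first.
  rewrite mulmx_contract; apply: eq_bigr => a _; rewrite mulmx_contract.
  by congr (_ * _); apply: eq_bigr => b _; rewrite (torsion_comp_xx RG cdu') mul1mx.
rewrite (_ : \sum_a _ =
    \sum_a \sum_b (Jx a j * Jx b i) *: curvature_mx (phimet RG d') a b u'.1.2).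
  by rewrite mul1mx -[u'.2]/(Jx *m u.2 *m K) !mulmxA law.
rewrite exchange_big /=; apply: eq_bigr => a _; rewrite scaler_sumr.
by apply: eq_bigr => b _; rewrite scalerA mulrC.
Qed.

Lemma sum_eqM (k y : 'I_p -> R) al : \sum_mu k mu * ((al == mu)%:R * y mu) = k al * y al.
Proof.
rewrite (bigD1 al) //= eqxx mul1r big1 ?addr0 // => mu ne.
by rewrite eq_sym (negPf ne) mul0r mulr0.
Qed.

Lemma tensor_law_vt j be al : tensor_law (IV j be) (IT al).
Proof.
move=> e'; rewrite !djac_suml.
under [RHS]eq_bigr do under eq_bigr do rewrite djac_suml.
case: e' => [[al'|i']|[i' mu']]; rewrite djac_sumr /F /F'.
- by both_zero (torsion_comp_vt RG cdu) (torsion_comp_vt RG cdu').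
- by both_zero (torsion_comp_vt RG cdu) (torsion_comp_vt RG cdu').
have law := G_mx_change RG ou al.
transitivity (- (K be mu' * (Jx *m G_mx S al u) i' j)).
  rewrite [(_ *m _) _ _]mxE mulr_sumr -sumrN; apply: eq_bigr => m _.
  transitivity (\sum_mu K mu mu' * ((be == mu)%:R * - (Jx i' m * G_mx S al u m j))).
    by apply: eq_bigr => mu _; rewrite (torsion_comp_vt RG cdu); ring.
  by rewrite sum_eqM; ring.
rewrite law [(_ *m _) _ _]mxE mulr_sumr -sumrN; apply: eq_bigr => j' _.
transitivity (\sum_be' K be be' * ((mu' == be')%:R *
   - (Jx j' j * \sum_al' Jt al' al * G_mx S' al' u' i' j'))).
  rewrite sum_eqM summxE mulrN; congr (- (_ * _)); rewrite mulrC; congr (_ * _).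
  by apply: eq_bigr => a _; rewrite mxE.
apply: eq_bigr => be' _; rewrite !mulr_sumr -sumrN !mulr_sumr.
by apply: eq_bigr => a _; rewrite (torsion_comp_vt RG cdu') eq_sym; ring.
Qed.

Lemma tensor_law_vx j be i : tensor_law (IV j be) (IX i).
Proof.
move=> e'; rewrite !djac_suml.
under [RHS]eq_bigr do under eq_bigr do rewrite djac_suml.
case: e' => [[al'|m']|[i' mu']]; rewrite djac_sumr /F /F'.
- by both_zero (torsion_comp_vx RG cdu) (torsion_comp_vx RG cdu').
- have law := C_mx_change RG ou be j.
  transitivity ((Jx *m C_mx S be j u) m' i).
    by rewrite mxE; apply: eq_bigr => m _; rewrite (torsion_comp_vx RG cdu).
  rewrite law mulmx_suml summxE; apply: eq_bigr => j' _.
  rewrite -scalemxAl [LHS]mxE mulmx_suml summxE mulr_sumr; apply: eq_bigr => be' _.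
  rewrite -scalemxAl [X in _ * X = _]mxE [(_ *m _) _ _]mxE !mulr_sumr; apply: eq_bigr => i' _.
  by rewrite (torsion_comp_vx RG cdu'); ring.
have law := L_sub_christoffel_change RG ou i.
pose Y := L_mx S i u - christoffel_mx (phimet RG d) i u.1.2.
pose Y' l := L_mx S' l u' - christoffel_mx (phimet RG d') l u'.1.2.
transitivity (- (K be mu' * (Jx *m Y) i' j)).
  rewrite [(_ *m _) _ _]mxE mulr_sumr -sumrN; apply: eq_bigr => m _.
  transitivity (\sum_mu K mu mu' * ((be == mu)%:R * - (Jx i' m * Y m j))).
    apply: eq_bigr => mu _; rewrite (torsion_comp_vx RG cdu).
    by rewrite /Y mx_sub_entry; ring.
  by rewrite sum_eqM; ring.
rewrite law -/Y [(_ *m _) _ _]mxE mulr_sumr -sumrN; apply: eq_bigr => j' _.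
transitivity (\sum_be' K be be' * ((mu' == be')%:R *
   - (Jx j' j * \sum_l Jx l i * Y' l i' j'))).
  rewrite sum_eqM summxE mulrN; congr (- (_ * _)); rewrite mulrC; congr (_ * _).
  by apply: eq_bigr => a _; rewrite mxE.
apply: eq_bigr => be' _; rewrite !mulr_sumr -sumrN !mulr_sumr.
apply: eq_bigr => a _; rewrite (torsion_comp_vx RG cdu') eq_sym.
by rewrite /Y' mx_sub_entry; ring.
Qed.

(** Each of the two terms of the component is [C] times a Kronecker delta, which
    absorbs one velocity Jacobian. *)
Lemma tensor_law_vv j be i al : tensor_law (IV j be) (IV i al).
Proof.
move=> e'; rewrite !djac_suml.
under [RHS]eq_bigr do under eq_bigr do rewrite djac_suml.
case: e' => [[al'|i']|[m' mu']]; rewrite djac_sumr /F /F'.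
- by both_zero (torsion_comp_vv RG cdu) (torsion_comp_vv RG cdu').
- by both_zero (torsion_comp_vv RG cdu) (torsion_comp_vv RG cdu').
transitivity (K al mu' * (Jx *m C_mx S be j u) m' i - K be mu' * (Jx *m C_mx S al j u) m' i).
  rewrite ![(_ *m _) _ _]mxE !mulr_sumr -sumrB; apply: eq_bigr => m _.
  transitivity (\sum_mu (K mu mu' * ((al == mu)%:R * (Jx m' m * C_mx S be j u m i))
      - K mu mu' * ((be == mu)%:R * (Jx m' m * C_mx S al j u m i)))).
    by apply: eq_bigr => mu _; rewrite (torsion_comp_vv RG cdu); ring.
  by rewrite sumrB !sum_eqM.
have QE be0 : (Jx *m C_mx S be0 j u) m' i =
    \sum_j' \sum_be' \sum_i' Jx j' j * K be0 be' * Jx i' i * C_mx S' be' j' u' m' i'.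
  rewrite (C_mx_change RG ou) mulmx_suml summxE; apply: eq_bigr => j' _.
  rewrite -scalemxAl [LHS]mxE mulmx_suml summxE mulr_sumr; apply: eq_bigr => be' _.
  rewrite -scalemxAl [X in _ * X = _]mxE [(_ *m _) _ _]mxE !mulr_sumr; apply: eq_bigr => i' _.
  by ring.
rewrite !QE !mulr_sumr -sumrB; apply: eq_bigr => j' _.
under [RHS]eq_bigr => be' _.
  rewrite (_ : \sum_i' _ =
    K al mu' * (\sum_i' Jx i' i * C_mx S' be' j' u' m' i')
    - (mu' == be')%:R * (\sum_i' Jx i' i * \sum_al' K al al' * C_mx S' al' j' u' m' i')).
    over.
  rewrite !mulr_sumr -sumrB; apply: eq_bigr => i' _.
  transitivity (\sum_al' (K al al' * ((mu' == al')%:R * (Jx i' i * C_mx S' be' j' u' m' i'))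
      - (mu' == be')%:R * (Jx i' i * (K al al' * C_mx S' al' j' u' m' i')))).
    apply: eq_bigr => al' _.
    by rewrite (torsion_comp_vv RG cdu') (eq_sym al') (eq_sym be'); ring.
  by rewrite sumrB sum_eqM -!mulr_sumr.
transitivity (\sum_be' (Jx j' j * K be be' *
     (K al mu' * \sum_i' Jx i' i * C_mx S' be' j' u' m' i')
   - K be be' * ((mu' == be')%:R * (Jx j' j *
       \sum_i' Jx i' i * \sum_al' K al al' * C_mx S' al' j' u' m' i')))); last first.
  by apply: eq_bigr => be' _; ring.
rewrite sumrB sum_eqM; congr (_ - _).
  rewrite mulr_sumr; apply: eq_bigr => be' _; rewrite !mulr_sumr; apply: eq_bigr => i' _.
  by ring.
rewrite exchange_big !mulr_sumr; apply: eq_bigr => i' _; rewrite !mulr_sumr.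
by apply: eq_bigr => al' _; ring.
Qed.

Lemma torsion_tensor_law a b : tensor_law a b.
Proof.
case: a => [[al|i]|[i al]]; case: b => [[be|j]|[j be]].
- exact: tensor_law_tt.
- exact/tensor_law_sym/tensor_law_xt.
- exact/tensor_law_sym/tensor_law_vt.
- exact: tensor_law_xt.
- exact: tensor_law_xx.
- exact/tensor_law_sym/tensor_law_vx.
- exact: tensor_law_vt.
- exact: tensor_law_vx.
- exact: tensor_law_vv.
Qed.

End Tensor.

Theorem theorem2p2 (R : realType) (p n : nat)
    (T : manifold R p) (M : manifold R n) (RG : rgogml T M) :
  (forall (c : chart T) (d : chart M) (u : jet R p n), jet_img c d u ->
    let S := local RG c d in
    [/\ (* adapted components *)
     [/\ (forall al be : 'I_p,
            torsion S (delta_t S be) (delta_t S al) u =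
            \sum_(m < n) \sum_(mu < p)
              (- \sum_(ga < p) curvature (hl S) ga mu al be u.1.1 * u.2 m ga)
                *: partial_v m mu u),
         (forall (al : 'I_p) (j : 'I_n),
            torsion S (delta_x S j) (delta_t S al) u =
            \sum_(m < n) (- Gcoef S m j al u) *: delta_x S m u
            + \sum_(m < n) \sum_(mu < p) (0 : R) *: partial_v m mu u) &
         (forall i j : 'I_n,
            torsion S (delta_x S j) (delta_x S i) u =
            \sum_(m < n) \sum_(mu < p)
              (\sum_(k < n) curvature (phil S) m k i j u.1.2 * u.2 k mu)
                *: partial_v m mu u)],
     [/\ (forall (al be : 'I_p) (j : 'I_n),
            torsion S (partial_v j be) (delta_t S al) u =
            \sum_(m < n) \sum_(mu < p)
              (- ((be == mu)%:R * Gcoef S m j al u)) *: partial_v m mu u),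
         (forall (be : 'I_p) (i j : 'I_n),
            torsion S (partial_v j be) (delta_x S i) u =
            \sum_(m < n) (C1 S be m i j u + C0 S be m i j u) *: delta_x S m u
            + \sum_(m < n) \sum_(mu < p)
                (- ((be == mu)%:R * Lambda S m i j u)) *: partial_v m mu u) &
         (forall (al be : 'I_p) (i j : 'I_n),
            torsion S (partial_v j be) (partial_v i al) u =
            \sum_(m < n) \sum_(mu < p)
              ((al == mu)%:R * Ccoef S m be i j u
               - (be == mu)%:R * Ccoef S m al i j u) *: partial_v m mu u)],
     (* these components determine the torsion *)
     (forall a b : idx p n,
        torsion S (frame S b) (frame S a) u =
        - torsion S (frame S a) (frame S b) u) &
     (forall X Y : jet R p n -> jet R p n,
        differentiable X u -> differentiable Y u ->
        torsion S X Y u =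
        \sum_a \sum_b (coframe S a u (X u) * coframe S b u (Y u))
                        *: torsion S (frame S a) (frame S b) u)])
  /\ d_tensor12 (fun c d => torsion_comp (local RG c d)).
Proof.
split=> [c d u cdu S|c c' d d' u ou a b e']; last first.
  rewrite (torsion_tensor_law RG ou a b e'); apply: eq_bigr => a' _; rewrite mulr_sumr.
  by apply: eq_bigr => b' _; rewrite mulrA.
split.
- by split=> *; [exact: torsion_tt|exact: torsion_xt|exact: torsion_xx].
- by split=> *; [exact: torsion_vt|exact: torsion_vx|exact: torsion_vv].
- by move=> a b; exact: torsion_antisym.
- move=> X Y dX dY; apply: torsion_frame_expand => //.
  + exact: Mcon_differentiable.
  + exact: Ncon_differentiable.
  + exact: frame_differentiable.
Qed.
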